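(* Let $\mathbf a=(a_n)_{n\in\mathbb{N}}$ be an increasing sequence of integers and let $\psi:\mathbb{N}\to\mathbb{R}_{\geq 0}$ be any function (no monotonicity assumed). Let $f$ be a dimension function such that $x\mapsto x^{-1}f(x)$ is monotonic. Then for Lebesgue-almost every $\alpha\in[0,1]$, the set \[W(\psi,\mathbf a,\alpha)=\{\gamma\in[0,1] : \lVert a_n\alpha-\gamma\rVert<\psi(n)\text{ for infinitely many } n\}\] satisfies \[\mathcal{H}^f(W(\psi,\mathbf a,\alpha))=\begin{cases}0 & \text{if } \sum_{n=1}^\infty f(\psi(n))<\infty,\\ \mathcal{H}^f([0,1]) & \text{if } \sum_{n=1}^\infty f(\psi(n))=\infty.\end{cases}\]
   Context: $\lVert x\rVert$ denotes the distance from the real number $x$ to the nearest integer. A dimension function is a continuous nondecreasing function $f:\mathbb{R}^+\to\mathbb{R}^+$ with $f(r)\to 0$ as $r\to 0$; $\mathcal{H}^f$ denotes the corresponding $f$-Hausdorff measure on $\mathbb{R}$. Where $\psi(n)=0$, the term $f(\psi(n))$ is interpreted as $0$. *)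

(* Defs.v *)
From HB Require Import structures.
From mathcomp Require Import all_boot all_order all_algebra.
From mathcomp Require Import all_classical all_reals all_analysis.

Set Implicit Arguments.
Unset Strict Implicit.
Unset Printing Implicit Defensive.

Import Order.TTheory GRing.Theory Num.Theory.
Import numFieldNormedType.Exports.

Local Open Scope classical_set_scope.
Local Open Scope ring_scope.

Section Defs.
Variable R : realType.
Implicit Types (f : R -> R) (x y r delta : R) (A U : set R).

Definition dist_int x : R := inf [set `|x - k%:~R| | k in [set: int]].

(* Functions R^+ -> R^+ are represented by total functions R -> R whose values
   outside ]0, +oo[ are irrelevant. *)
Definition dimension_function f : Prop :=
  [/\ {in `]0, +oo[, forall x, 0 < f x},
      {in `]0, +oo[, continuous f},
      {in `]0, +oo[ &, {homo f : x y / x <= y}} &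
      f r @[r --> 0^'+] --> (0 : R)].

Definition monotonic_on_pos (g : R -> R) : Prop :=
  {in `]0, +oo[ &, {homo g : x y / x <= y}} \/
  {in `]0, +oo[ &, {homo g : x y / x <= y >-> y <= x}}.

(* f extended by the convention f(0) = 0. *)
Definition dimf0 f r : R := if r == 0 then 0 else f r.

(* The maximum with 0 gives the empty set diameter 0, as ereal_sup set0 = -oo. *)
Definition diam U : \bar R :=
  maxe 0%E (ereal_sup [set `|p.1 - p.2|%:E | p in U `*` U]).

(* The covering sets may be empty, so finite covers are included. *)
Definition hausdorff_content f delta A : \bar R :=
  ereal_inf [set (\sum_(0 <= i <oo) (dimf0 f (fine (diam (U i))))%:E)%E |
             U in [set U : nat -> set R |
                   A `<=` \bigcup_i U i /\
                   forall i, (diam (U i) <= delta%:E)%E]].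

Definition hausdorff_measure f A : \bar R :=
  ereal_sup [set hausdorff_content f delta A | delta in [set d : R | 0 < d]].

(* Sequences indexed by {1, 2, ...} are functions on nat whose value at 0 is
   irrelevant. *)
Definition W (psi : nat -> R) (a : nat -> int) (alpha : R) : set R :=
  [set gamma : R | gamma \in `[0, 1] /\
    infinite_set [set n : nat | (0 < n)%N /\
                   dist_int ((a n)%:~R * alpha - gamma) < psi n]].

End Defs.

(* Main.v *)
Require Import Defs.
From HB Require Import structures.
From mathcomp Require Import all_boot all_order all_algebra.
From mathcomp Require Import all_classical all_reals all_analysis measurable_realfun.
From mathcomp Require Import ring lra zify.

(* The events "dist_int (a n * alpha - gamma) < phi n" are pairwise independent on the
   unit square, because (alpha, gamma) |-> (a m * alpha - gamma, (a n - a m) * alpha)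
   preserves the measure of the torus; by Chebyshev, W phi a alpha has full measure
   for almost every alpha as soon as the sum of the phi n diverges.

   If f x <= C * x near 0, Lebesgue null sets are H^f-null, and the case phi = psi
   concludes. Otherwise f x / x increases to infinity at 0, and H^f (W psi a alpha)
   is infinite: the case phi = f o psi supplies large balls covering almost every
   point infinitely often, and, given a cover of W psi a alpha with finite f-sum, one
   finds nested small balls whose common point is missed by the cover. No measure on
   a Cantor set is needed, as the cover is fixed before the balls are chosen. *)

Set Implicit Arguments.
Unset Strict Implicit.

Import Order.TTheory GRing.Theory Num.Theory.
Import numFieldNormedType.Exports.

Local Open Scope classical_set_scope.
Local Open Scope ring_scope.

Section circle.
Variable R : realType.
Local Notation mu := (@lebesgue_measure R).
Implicit Types (s t : R).

Definition int_periodic (A : set R) := forall x, A (x + 1) <-> A x.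

Lemma measurable_fun_affine (c s : R) :
  measurable_fun [set: R] (fun x : R => c * x + s).
Proof. by apply: measurable_funD => //; exact: mulrl_measurable. Qed.

Lemma measurable_affine_preimage (c s : R) (A : set R) :
  measurable A -> measurable [set x : R | A (c * x + s)].
Proof.
by move=> mA; rewrite -[X in measurable X]setTI; exact: (@measurable_fun_affine c s).
Qed.

Lemma lebesgue_measure_affine (c s : R) (A : set R) : 0 < c -> measurable A ->
  mu A = (c%:E * mu [set x : R | A (c * x + s)%R])%E.
Proof.
move=> c0 mA.
pose phi : measurableTypeR R -> measurableTypeR R := fun x : R => c * x + s.
have mphi : measurable_fun setT phi by exact: measurable_fun_affine.
pose nu := mscale (NngNum (ltW c0)) (pushforward mu phi).
have -> : (c%:E * mu [set x : R | A (c * x + s)%R])%E = nu mphi A by [].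
apply: lebesgue_measure_unique => // X [[a b] _ <-] /=.
rewrite /nu /mscale /= /pushforward.
have -> : phi @^-1` `]a, b] = `](a - s) / c, (b - s) / c]%classic.
  apply/seteqP; split => x /=; rewrite !in_itv/= /phi;
    by rewrite ltr_pdivrMr// ler_pdivlMr// ltrBlDr lerBrDr mulrC.
rewrite !lebesgue_measure_itv/= !lte_fin ltr_pM2r ?invr_gt0// ltrD2r.
case: ifPn => _; last by rewrite mule0.
rewrite -EFinD -EFinM; congr (_%:E); field; exact: lt0r_neq0.
Qed.

Lemma lebesgue_measure_shift s (A : set R) : measurable A ->
  mu [set x : R | A (x + s)] = mu A.
Proof.
move=> mA; rewrite (lebesgue_measure_affine s ltr01 mA) mul1e.
by congr (mu _); apply/seteqP; split => x /=; rewrite mul1r.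
Qed.

Lemma int_periodic_shift (A : set R) (k : int) (x : R) :
  int_periodic A -> A (x + k%:~R) <-> A x.
Proof.
move=> pA; have H (n : nat) y : A (y + n%:R) <-> A y.
  elim: n => [|n IH]; first by rewrite addr0.
  by rewrite -natr1 addrA; split => [/pA /IH//|?]; apply/pA/IH.
case: k => n; first exact: H.
rewrite NegzE mulrNz -{2}(subrK n.+1%:~R x); exact: iff_sym (H _ _).
Qed.

Lemma lebesgue_measure_period_itv s (A : set R) :
  measurable A -> int_periodic A ->
  mu (`[s, s + 1[ `&` A) = mu (`[0, 1[ `&` A).
Proof.
move=> mA pA.
pose k := Num.floor s; pose t := s - k%:~R.
have /andP[t0 t1] : 0 <= t < 1.
  by rewrite /t subr_ge0 ltrBlDl -intrD1 floor_le floorD1_gt.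
have -> : mu (`[s, s + 1[ `&` A) = mu (`[t, t + 1[ `&` A).
  rewrite -(lebesgue_measure_shift k%:~R); last exact: measurableI.
  congr (mu _); apply/seteqP; split => x /=.
    rewrite !in_itv/= => -[/andP[h1 h2] /int_periodic_shift Ax]; split; last exact: Ax.
    by rewrite /t lerBlDr h1/= -addrAC ltrBrDr.
  rewrite !in_itv/= => -[/andP[h1 h2] Ax]; split; last exact/int_periodic_shift.
  move: h1 h2; rewrite /t lerBlDr => -> /=.
  by rewrite addrAC ltrBrDr.
have -> : (`[t, t + 1[ `&` A : set R) = (`[t, 1[ `&` A) `|` (`[1, t + 1[ `&` A).
  rewrite -setIUl; congr (_ `&` _); apply/seteqP; split => x /=; rewrite !in_itv/=.
    by move=> /andP[-> ->]; rewrite andbT /=; case: (ltP x 1) => ?; [left|right].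
  move=> [/andP[-> /=]|/andP[]]; first by move=> /lt_le_trans; apply; rewrite lerDr.
  by move=> x1 ->; rewrite (le_trans _ x1)// ltW.
have -> : (`[0, 1[ `&` A : set R) = (`[t, 1[ `&` A) `|` (`[0, t[ `&` A).
  rewrite -setIUl; congr (_ `&` _); apply/seteqP; split => x /=; rewrite !in_itv/=.
    by move=> /andP[-> ->]; rewrite andbT /=; case: (ltP x t) => ?; [right|left].
  move=> [/andP[h1 ->]|/andP[-> h2]]; rewrite ?andbT ?(le_trans t0)//.
  by rewrite (lt_trans h2).
rewrite !measureU//; do ?[exact: measurableI]; last 2 first.
- apply/seteqP; split => x //= [[+ _] [+ _]]; rewrite !in_itv/=.
  by move=> /andP[h1 h2] /andP[h3 h4]; move: (lt_le_trans h4 h1); rewrite ltxx.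
- apply/seteqP; split => x //= [[+ _] [+ _]]; rewrite !in_itv/=.
  by move=> /andP[h1 h2] /andP[h3 h4]; move: (lt_le_trans h2 h3); rewrite ltxx.
congr (_ + _)%E; rewrite -[LHS](lebesgue_measure_shift 1); last exact: measurableI.
congr (mu _); apply/seteqP; split => x /=; rewrite !in_itv/= lerDr ltrD2r.
  by move=> [-> /pA].
by move=> [-> ?]; split => //; exact/pA.
Qed.

Lemma lebesgue_measure_periods_itv s (d : nat) (A : set R) :
  measurable A -> int_periodic A ->
  mu (`[s, s + d%:R[ `&` A) = (d%:R%:E * mu (`[0%R, 1%R[ `&` A))%E.
Proof.
move=> mA pA; elim: d => [|d IH].
  by rewrite addr0 mul0e set_itvco0 set0I measure0.
have -> : (`[s, s + d.+1%:R[ `&` A : set R) =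
    (`[s, s + d%:R[ `&` A) `|` (`[s + d%:R, s + d%:R + 1[ `&` A).
  rewrite -setIUl; congr (_ `&` _); apply/seteqP; split => x /=; rewrite !in_itv/= -natr1 addrA.
    by move=> /andP[-> ->]; rewrite andbT /=; case: (ltP x (s + d%:R)) => ?; [left|right].
  move=> [/andP[-> /=]|/andP[]]; first by move=> /lt_le_trans; apply; rewrite lerDl.
  by move=> x1 ->; rewrite (le_trans _ x1)// lerDl.
rewrite measureU//; do ?[exact: measurableI]; last first.
  apply/seteqP; split => x //= [[+ _] [+ _]]; rewrite !in_itv/=.
  by move=> /andP[h1 h2] /andP[h3 h4]; move: (lt_le_trans h2 h3); rewrite ltxx.
rewrite [X in (_ + X)%E]lebesgue_measure_period_itv//.
rewrite -natr1 EFinD ge0_muleDl ?mul1e//; congr (_ + _)%E; exact: IH.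
Qed.

Lemma lebesgue_measure_expanding_preimage (d : nat) s (A : set R) :
  (0 < d)%N -> measurable A -> int_periodic A ->
  mu (`[0, 1[ `&` [set x : R | A (d%:R * x + s)]) = mu (`[0, 1[ `&` A).
Proof.
move=> d0 mA pA; have d0' : 0 < d%:R :> R by rewrite ltr0n.
have mB : measurable (`[s, s + d%:R[ `&` A : set R) by exact: measurableI.
have := lebesgue_measure_affine s d0' mB.
rewrite lebesgue_measure_periods_itv// => /esym.
set X := (X in mu X).
have -> : X = (`[0, 1[ `&` [set x : R | A (d%:R * x + s)]).
  apply/seteqP; rewrite /X; split => x /=; rewrite !in_itv/= lerDr (addrC s d%:R) ltrD2r pmulr_rge0//;
  by rewrite gtr_pMr.
have F (B : set R) : measurable B -> mu (`[0%R, 1%R[ `&` B) \is a fin_num.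
  move=> mB'; rewrite ge0_fin_numE//; apply: (@le_lt_trans _ _ (mu `[0%R, 1%R[)).
    by apply: le_measure; rewrite ?inE//; exact: measurableI.
  by rewrite lebesgue_measure_itv/= lte01 ltry.
have F1 := F _ mA; have F2 := F _ (measurable_affine_preimage d%:R s mA).
rewrite -(fineK F1) -(fineK F2) -!EFinM => -[] /mulfI ->//.
by rewrite lt0r_neq0.
Qed.

End circle.

Section pairwise_borel_cantelli.
Context d (T : measurableType d) (R : realType).
Variables (mu : {measure set T -> \bar R}) (D : set T).
Hypotheses (mD : measurable D) (muD : mu D = 1%E).
Implicit Types A : (set T)^nat.

Definition pairwise_independent A := forall m n, (m < n)%N ->
  mu (A m `&` A n) = (mu (A m) * mu (A n))%E.

Let fin_sub B : measurable B -> B `<=` D -> mu B = (fine (mu B))%:E.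
Proof.
move=> mB BD; rewrite fineK// ge0_fin_numE//.
by rewrite (@le_lt_trans _ _ (mu D)) ?le_measure ?inE// muD ltry.
Qed.

(* The pointwise inequality behind Chebyshev's: on Z every A i is absent, so
   (S - M)^2 = M^2 there; all terms are moved to keep them nonnegative. *)
Let second_moment A N (p := fun i => fine (mu (A i)))
    (M := \sum_(i < N) p i) (Z := D `\` \bigcup_i A i) :
  (forall n, measurable (A n)) -> (forall n, A n `<=` D) ->
  pairwise_independent A -> M ^+ 2 * fine (mu Z) <= M.
Proof.
move=> mA AD indep.
have mZ : measurable Z by apply: measurableD => //; exact: bigcupT_measurable.
have ZD : Z `<=` D by move=> x [].
have M0 : 0 <= M by apply: sumr_ge0 => i _; exact: fine_ge0.
have mI (B : set T) : measurable B -> measurable_fun setT (fun x => (\1_B x : R)%:E).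
  by move=> mB; apply/measurable_EFinP; exact: measurable_indic.
have I0 (B : set T) x : (0 <= (\1_B x : R)%:E)%E by rewrite lee_fin.
have pE i : mu (A i) = (p i)%:E by exact: fin_sub.
pose S x := (\sum_(i < N) (\1_(A i) x : R)%:E)%E.
pose Q x := (\sum_(i < N) \sum_(j < N) (\1_(A i `&` A j) x : R)%:E)%E.
have mS : measurable_fun setT S by apply: emeasurable_sum => i; exact: mI.
have mQ : measurable_fun setT Q.
  apply: emeasurable_sum => i; apply: emeasurable_sum => j; apply: mI.
  exact: measurableI.
have S0 x : (0 <= S x)%E by apply: sume_ge0.
have Q0 x : (0 <= Q x)%E by apply: sume_ge0 => i _; apply: sume_ge0.
have key x : ((M ^+ 2)%:E * (\1_Z x)%:E + (2 * M)%:E * S x <=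
              Q x + (M ^+ 2)%:E * (\1_D x)%:E)%E.
  have -> : S x = (\sum_(i < N) (\1_(A i) x : R))%:E by rewrite /S sumEFin.
  have -> : Q x = ((\sum_(i < N) (\1_(A i) x : R)) ^+ 2)%:E.
    rewrite expr2 mulr_suml /Q -sumEFin; apply: eq_bigr => i _.
    rewrite mulr_sumr -sumEFin; apply: eq_bigr => j _.
    by rewrite indicI.
  rewrite -!EFinM -!EFinD lee_fin.
  set s := \sum_(i < N) _.
  have [xZ|xZ] := pselect (Z x).
    have -> : s = 0.
      rewrite /s big1// => i _; rewrite indicE memNset// => Aix.
      by case: xZ => _; apply; exists i.
    rewrite !indicE !mem_set//; [lra|exact: ZD].
  have [xD|xD] := pselect (D x).
    rewrite !indicE (mem_set xD) (memNset xZ) /=.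
    have := sqr_ge0 (s - M); rewrite sqrrB; nra.
  have -> : s = 0.
    by rewrite /s big1// => i _; rewrite indicE memNset// => /AD.
  by rewrite !indicE !memNset//=; lra.
have intS : (\int[mu]_x S x = M%:E)%E.
  rewrite /S ge0_integral_sum//; last by move=> i; exact: mI.
  rewrite /M -sumEFin; apply: eq_bigr => i _.
  by rewrite integral_indic// setIT.
have intQ : (\int[mu]_x Q x <= (M + M ^+ 2)%:E)%E.
  rewrite /Q ge0_integral_sum//; last 2 first.
  - by move=> i; apply: emeasurable_sum => j; apply: mI; exact: measurableI.
  - by move=> i x _; exact: sume_ge0.
  rewrite expr2 mulr_suml /M -big_split/= -sumEFin; apply: lee_sum => i _.
  rewrite ge0_integral_sum//; last by move=> j; apply: mI; exact: measurableI.
  apply: (@le_trans _ _ (\sum_(j < N) ((if j == i then p i else 0) + p i * p j)%:E)%E).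
    apply: lee_sum => j _; rewrite integral_indic ?setIT//; last exact: measurableI.
    case: eqP => [->|/eqP ji].
      rewrite setIid pE lee_fin lerDl mulr_ge0//; exact: fine_ge0.
    rewrite add0r EFinM -!pE.
    have [lt|lt|/val_inj e] := ltngtP i j; first by rewrite indep.
      by rewrite setIC indep// muleC.
    by rewrite e eqxx in ji.
  by rewrite sumEFin lee_fin big_split/= -mulr_sumr -big_mkcond/= big_pred1_eq.
have mc (k : R) (g : T -> \bar R) : measurable_fun setT g ->
    measurable_fun setT (fun x => k%:E * g x)%E by exact: measurable_funeM.
have : (\int[mu]_x ((M ^+ 2)%:E * (\1_Z x)%:E + (2 * M)%:E * S x) <=
        \int[mu]_x (Q x + (M ^+ 2)%:E * (\1_D x)%:E))%E.
  apply: ge0_le_integral => //.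
  - by move=> x _; rewrite adde_ge0// mule_ge0// lee_fin ?sqr_ge0// mulr_ge0.
  - by apply: emeasurable_funD; apply: mc => //; exact: mI.
  - by apply: emeasurable_funD => //; apply: mc; exact: mI.
rewrite !ge0_integralD//; last first.
all: try by move=> x _; rewrite mule_ge0// lee_fin ?sqr_ge0// mulr_ge0.
all: try by apply: mc => //; exact: mI.
rewrite !ge0_integralZl_EFin//; last first.
all: try exact: mI.
all: try by rewrite ?sqr_ge0 ?mulr_ge0.
rewrite intS !integral_indic// !setIT muD (fin_sub mZ ZD) => h.
have := le_trans h (leeD2r _ intQ).
rewrite -!EFinM -!EFinD lee_fin; nra.
Qed.

Let uncovered0 A : (forall n, measurable (A n)) -> (forall n, A n `<=` D) ->
  pairwise_independent A -> (\sum_(n <oo) mu (A n) = +oo)%E ->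
  mu (D `\` \bigcup_i A i) = 0%E.
Proof.
move=> mA AD indep div.
set Z := D `\` _.
have mZ : measurable Z by apply: measurableD => //; exact: bigcupT_measurable.
have ZD : Z `<=` D by move=> x [].
rewrite (fin_sub mZ ZD); congr (_%:E); apply/eqP; apply: contraPT div => z0.
have {}z0 : 0 < fine (mu Z) by rewrite lt_neqAle eq_sym z0 fine_ge0.
apply/eqP; rewrite lt_eqF//.
apply: (@le_lt_trans _ _ ((fine (mu Z))^-1)%:E); last by rewrite ltry.
apply: lime_le; first exact: is_cvg_nneseries.
apply: nearW => N; rewrite big_mkord (eq_bigr (fun i : 'I_N => (fine (mu (A i)))%:E)).
  rewrite sumEFin lee_fin; have := second_moment N mA AD indep.
  set M := \sum_(i < N) _ => H.
  have : 0 <= M by apply: sumr_ge0 => i _; exact: fine_ge0.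
  rewrite le_eqVlt => /predU1P[<-|M0]; first by rewrite invr_ge0 ltW.
  rewrite -[leRHS]mul1r ler_pdivlMr//.
  by rewrite -(ler_pM2l M0) mulr1 mulrA -expr2.
by move=> i _; exact: fin_sub.
Qed.

Lemma pairwise_borel_cantelli A :
  (forall n, measurable (A n)) -> (forall n, A n `<=` D) ->
  pairwise_independent A -> (\sum_(n <oo) mu (A n) = +oo)%E ->
  mu (D `\` lim_sup_set A) = 0%E.
Proof.
move=> mA AD indep div.
have mU n : measurable (\bigcup_i A (i + n)%N) by exact: bigcupT_measurable.
have Z0 n : mu (D `\` \bigcup_i A (i + n)%N) = 0%E.
  apply: uncovered0 => //.
    by move=> i j ij; apply: indep; rewrite ltn_add2r.
  have := nneseries_split 0 n (fun k _ => measure_ge0 mu (A k)).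
  rewrite div add0n -nneseries_addn// => /esym.
  rewrite (eq_bigr (fun i => (fine (mu (A i)))%:E)); last first.
    by move=> i _; exact: fin_sub.
  by rewrite sumEFin; case: (X in (_ + X)%E) => //.
apply/eqP; rewrite -measure_le0.
have -> : D `\` lim_sup_set A = \bigcup_n (D `\` \bigcup_i A (i + n)%N).
  rewrite setDE /lim_sup_set setC_bigcap setI_bigcupr.
  apply: eq_bigcupr => n _; rewrite setDE; congr (_ `&` ~` _).
  apply/seteqP; split => [x [j /= nj Ax]|x [j _ Ax]].
    by exists (j - n)%N => //; rewrite subnK.
  by exists (j + n)%N => //=; rewrite leq_addl.
have mDU n : measurable (D `\` \bigcup_i A (i + n)%N) by exact: measurableD.
apply: le_trans (measure_sigma_subadditive mu mDU (bigcupT_measurable _ mDU) _) _ => //.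
by rewrite eseries0// => n _ _; exact: Z0.
Qed.

End pairwise_borel_cantelli.

Lemma infinite_set_natP (P : set nat) :
  infinite_set P <-> forall N, exists2 n, (N <= n)%N & P n.
Proof.
split=> [inf N|H fin].
  apply: contrapT => H; apply: inf; apply: (@sub_finite_set _ _ `I_N) => //.
  move=> n Pn /=; rewrite ltnNge; apply/negP => Nn; apply: H; by exists n.
have [n Pn] : exists n, forall k, P k -> (k < n)%N.
  have /finite_seqP[F PF] := fin; exists (\max_(k <- F) k).+1 => k.
  by rewrite PF/= ltnS => kF; exact: (@leq_bigmax_seq _ _ xpredT id).
by have [k nk /Pn] := H n; rewrite ltnNge nk.
Qed.

Lemma nneseries_from1 (R : realType) (u : nat -> \bar R) :
  (forall n, (0 < n)%N -> (0 <= u n)%E) ->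
  (\sum_(1 <= n <oo) u n = \sum_(n <oo) u n.+1)%E.
Proof.
move=> u0; pose v n := if n is 0%N then 0%E else u n.
rewrite ereal_series (eq_eseriesr (g := v)) -?ereal_series; last by case.
rewrite -(@nneseries_addn _ v 1); last by case=> [|n]; rewrite /v// u0.
by apply: eq_eseriesr => n _; rewrite addn1.
Qed.

Section dist_int.
Variable R : realType.
Implicit Types (x e : R).

Lemma dist_int_ltP x e : dist_int x < e <-> exists k : int, `|x - k%:~R| < e.
Proof.
set S := [set `|x - k%:~R| | k in [set: int]].
have Sinf : has_inf S.
  split; first by exists `|x - 0%:~R|, 0.
  by exists 0 => _ [k _ <-].
split=> [xe|[k ke]].
  have e0 : 0 < e - dist_int x by rewrite subr_gt0.
  have [_ [k _ <-]] := inf_adherent e0 Sinf.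
  by rewrite [ltRHS]addrC subrK; exists k.
by apply: le_lt_trans ke; apply: ge_inf; [case: Sinf|exists k].
Qed.

Lemma dist_intN x : dist_int (- x) = dist_int x.
Proof.
rewrite /dist_int; congr inf; apply/seteqP; split => _ [k _ <-]; exists (- k) => //;
by rewrite mulrNz -normrN; congr `|_|; ring.
Qed.

Lemma dist_int_int_periodic e : int_periodic [set x | dist_int x < e].
Proof.
move=> x /=; split => /dist_int_ltP[k ke]; apply/dist_int_ltP.
  by exists (k - 1); move: ke; rewrite intrB opprB addrA.
by exists (k + 1); rewrite intrD opprD addrACA subrr addr0.
Qed.

Lemma measurable_dist_int_lt e : measurable [set x : R | dist_int x < e].
Proof.
have -> : [set x : R | dist_int x < e] = \bigcup_(k : int) ball (k%:~R : R) e.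
  apply/seteqP; split => x.
    by move=> /dist_int_ltP[k ke]; exists k => //; rewrite /ball/= distrC.
  by move=> [k _]; rewrite /ball/= distrC => ?; apply/dist_int_ltP; exists k.
by apply: open_measurable; apply: bigcup_open => k _; exact: ball_open.
Qed.

End dist_int.

Section twisted_full_measure.
Variable R : realType.
Local Notation mu := (@lebesgue_measure R).
Local Notation T := (measurableTypeR R).
Variables (a : nat -> int) (phi : nat -> R).
Hypothesis a_incr : forall m n : nat, (0 < m)%N -> (m < n)%N -> a m < a n.
Hypothesis phi_ge0 : forall n : nat, (0 < n)%N -> 0 <= phi n.

Let I : set T := `[0%R, 1%R[%classic.
Let A n : set T := [set x : R | dist_int x < phi n].
Let E n : set (T * T) := (I `*` I) `&` [set z | A n ((a n)%:~R * z.1 - z.2)].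

Let mI : measurable I. Proof. exact: measurable_itv. Qed.

Let muI : mu I = 1%E.
Proof. by rewrite /I lebesgue_measure_itv/= lte01 -EFinB subr0. Qed.

Let mA n : measurable (A n). Proof. exact: measurable_dist_int_lt. Qed.

Let measurable_lin (c : R) (k : nat) :
  measurable [set z : T * T | A k (c * z.1 - z.2)].
Proof.
rewrite -[X in measurable X]setTI.
apply: (_ : measurable_fun setT (fun z : T * T => (c * z.1 - z.2 : T))) => //.
apply: measurable_funB; last exact: measurable_snd.
apply: measurable_funM; last exact: measurable_fst.
exact: measurable_cst.
Qed.

Let mE n : measurable (E n).
Proof. by apply: measurableI; [exact: measurableX|exact: measurable_lin]. Qed.

Let product_const (J : set T) (G : set (T * T)) (c : \bar R) : (0 <= c)%E ->
  measurable J -> (forall x, mu (xsection G x) = c * (\1_J x)%:E)%E ->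
  (mu \x mu)%E G = (c * mu J)%E.
Proof.
move=> c0 mJ H; rewrite /product_measure1.
under eq_integral do rewrite /= H.
rewrite ge0_integralZl//; first by rewrite integral_indic// setIT.
by apply/measurable_EFinP; exact: measurable_indic.
Qed.

Let AN n x : A n (- x) = A n x.
Proof. by rewrite /A/= dist_intN. Qed.

Let pA n : int_periodic (A n). Proof. exact: dist_int_int_periodic. Qed.

Let rotate (B : set R) (s : R) : measurable B -> int_periodic B ->
  mu (I `&` [set x : R | B (x + s)]) = mu (I `&` B).
Proof.
move=> mB pB; rewrite -(@lebesgue_measure_expanding_preimage R 1 s B)//.
by congr (mu (_ `&` _)); apply/seteqP; split => x /=; rewrite mul1r.
Qed.

Let muE n : (mu \x mu)%E (E n) = mu (I `&` A n).
Proof.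
rewrite -[RHS]mule1 -muI; apply: (@product_const I) => // x.
rewrite indicE; case: (boolP (x \in I)) => xI; rewrite ?mule1 ?mule0.
  rewrite -(rotate (- ((a n)%:~R * x)) (mA n) (pA n)); congr (mu _).
  apply/seteqP; split => y; rewrite /xsection/= inE.
    by move=> [[_ yI]] /=; rewrite -AN opprB.
  by move=> [yI] /=; rewrite -AN opprB => ?; split => //; split => //; exact/set_mem.
rewrite [X in mu X](_ : _ = set0) ?measure0// -subset0 => y.
rewrite /xsection/= inE => -[[/= + _] _].
by rewrite -[_ x]/(I x) => /mem_set; rewrite (negbTE xI).
Qed.

Let indepE m n : (0 < m)%N -> (m < n)%N ->
  (mu \x mu)%E (E m `&` E n) = ((mu \x mu)%E (E m) * (mu \x mu)%E (E n))%E.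
Proof.
move=> m0 mn; rewrite !muE.
pose d := absz (a n - a m).
have dE : d%:R = (a n - a m)%:~R :> R.
  by rewrite /d pmulrn gez0_abs// subr_ge0 ltW// a_incr.
have d0 : (0 < d)%N by rewrite absz_gt0 subr_eq0 gt_eqF// a_incr.
pose G : set (T * T) := (I `*` (I `&` A m)) `&` [set z | A n (d%:R * z.1 - z.2)].
have mG : measurable G.
  by apply: measurableI; [apply: measurableX => //; exact: measurableI|exact: measurable_lin].
transitivity ((mu \x mu)%E G).
  apply: eq_integral => x _ /=.
  have [xI|xI] := pselect (I x); last first.
    rewrite [X in mu X = _](_ : _ = set0); last first.
      by rewrite -subset0 => y; rewrite /xsection/= inE => -[[[/= /xI]]].
    rewrite [X in _ = mu X](_ : _ = set0)//.
    by rewrite -subset0 => y; rewrite /xsection/= inE => -[[/= /xI]].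
  pose H : set R := A m `&` [set u : R | A n (d%:R * x - u)].
  have mH : measurable H.
    apply: measurableI; first exact: mA.
    rewrite [X in measurable X](_ : _ = [set u : R | A n (-1 * u + d%:R * x)]).
      exact: (measurable_affine_preimage _ _ (mA n)).
    by apply/seteqP; split => u /=; rewrite mulN1r (addrC (- u)).
  have pH : int_periodic H.
    move=> u; split => -[h1 h2]; split.
    - exact: (iffLR (pA m u)).
    - by move: (iffRL (pA n _) h2); rewrite opprD addrA subrK.
    - exact: (iffRL (pA m u)).
    - by apply: (iffLR (pA n _)); rewrite opprD addrA subrK.
  transitivity (mu (I `&` [set y : R | H (y - (a m)%:~R * x)])).
    congr (mu _); apply/seteqP; split => y; rewrite /xsection/= inE.
      move=> [[_ h1] [[_ yI] h2]]; split => //; split => /=.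
        by rewrite -AN opprB.
      move: h2 => /=; rewrite dE intrB; congr (A n _); ring.
    move=> [yI [h1 h2]]; split; split => //=.
      by rewrite -AN opprB.
    move: h2 => /=; rewrite dE intrB; congr (A n _); ring.
  rewrite rotate//; congr (mu _); apply/seteqP; split => y; rewrite /xsection/= inE.
    by move=> [yI [h1 h2]].
  by move=> [[_ [yI h1]] h2].
have -> : (mu \x mu)%E G = (mu \x^ mu)%E G.
  by apply: product_measure_unique => //= B C mB mC; rewrite product_measure2E.
rewrite /product_measure2 muleC.
rewrite (eq_integral (fun y => mu (I `&` A n) * (\1_(I `&` A m) y)%:E)%E); last first.
  move=> y _ /=; rewrite indicE; case: (boolP (y \in _)) => yI; rewrite ?mule1 ?mule0.
    rewrite -(lebesgue_measure_expanding_preimage (- y) d0 (mA n) (pA n)); congr (mu _).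
    apply/seteqP; split => x; rewrite /ysection/= inE; first by move=> [[/= xI _]].
    by move=> [xI h]; split => //; split => //; exact/set_mem.
  rewrite [X in mu X](_ : _ = set0) ?measure0// -subset0 => x.
  rewrite /ysection/= inE => -[[_ yIA] _].
  by move/negP : yI; apply; exact/mem_set.
rewrite ge0_integralZl//.
- by rewrite integral_indic ?setIT//; exact: measurableI.
- by apply/measurable_EFinP; apply: measurable_indic; exact: measurableI.
Qed.

Lemma twisted_full_measure :
  (\sum_(1 <= n <oo) (Num.min (phi n) 1)%:E = +oo)%E ->
  {ae mu, forall alpha : R, alpha \in `[0, 1] ->
    mu.-negligible (`[0, 1]%classic `\` W phi a alpha)}.
Proof.
move=> div.
pose F n := E n.+1.
have FD n : F n `<=` I `*` I by move=> z [].
have muII : (mu \x mu)%E (I `*` I) = 1%E.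
  transitivity (mu I * mu I)%E; first exact: product_measure1E.
  by rewrite muI mule1.
have mF n : measurable (F n) by exact: mE.
have indepF : pairwise_independent (mu \x mu)%E F by move=> i j ij; exact: indepE.
have divF : (\sum_(n <oo) (mu \x mu) (F n) = +oo)%E.
  have p0 i : (0 <= (Num.min (phi i.+1) 1)%:E)%E.
    by rewrite lee_fin le_min ler01 andbT phi_ge0.
  apply/eqP; rewrite -leye_eq -div nneseries_from1; last by case.
  apply: lee_nneseries => // i _; rewrite muE.
  have -> : (Num.min (phi i.+1) 1)%:E = mu `[0%R, Num.min (phi i.+1) 1[%classic.
    rewrite lebesgue_measure_itv/= lte_fin; case: ltP => h; first by rewrite -EFinB subr0.
    by congr (_%:E); apply/eqP; rewrite eq_le h le_min ler01 andbT phi_ge0.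
  apply: le_measure; rewrite ?inE; [exact: measurable_itv|exact: measurableI|].
  move=> x /=; rewrite in_itv/= lt_min => /and3P[x0 xp x1]; split.
    by rewrite /I/= in_itv/= x0.
  by apply/dist_int_ltP; exists 0; rewrite subr0 ger0_norm.
have mII : measurable (I `*` I) by exact: measurableX.
have Z0 := pairwise_borel_cantelli mII muII mF FD indepF divF.
set Z := _ `\` _ in Z0.
have mZ : measurable Z.
  apply: measurableD => //; apply: bigcapT_measurable => n.
  by apply: bigcup_measurable => k _; exact: mF.
have /ae_eq_integral_abs : (\int[mu]_x `|mu (xsection Z x)| = 0)%E.
  by rewrite -[RHS]Z0; apply: eq_integral => x _; rewrite gee0_abs.
move=> /(_ measurableT (measurable_fun_xsection _ mZ)) H.
have N1 : {ae mu, forall x, x <> 1}.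
  exists [set 1]; split; [exact: measurable_set1|exact: lebesgue_measure_set1|].
  by move=> x /= /contrapT.
apply: filterS2 H N1 => x /(_ Logic.I) /= Zx x1 /[!in_itv]/= /andP[x0 x1'].
have xI : I x by rewrite /I/= in_itv/= x0 lt_neqAle x1' andbT; exact/eqP.
apply: (@negligibleS _ _ _ _ (xsection Z x `|` [set 1])); last first.
  apply: negligibleU.
    by apply/negligibleP => //; exact: measurable_xsection.
  by apply/negligibleP; [exact: measurable_set1|exact: lebesgue_measure_set1].
move=> y [/= yI nW]; have [->|/eqP y1] := pselect (y = 1); first by right.
left; rewrite /xsection/= inE; split.
  split => //=; move: yI; rewrite /I/= !in_itv/= => /andP[-> ?].
  by rewrite lt_neqAle y1.
move=> L; apply: nW; split; first by rewrite inE in yI *.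
apply/infinite_set_natP => N; have [n /= Nn [_ h]] := L N Logic.I.
by exists n.+1 => //; rewrite (leq_trans Nn).
Qed.

End twisted_full_measure.

Lemma nneseries_small (R : realType) (u : nat -> R) (e : R) :
  (forall n, 0 <= u n) -> (\sum_(0 <= n <oo) (u n)%:E < +oo)%E -> 0 < e ->
  exists N, forall n, (N <= n)%N -> u n <= e.
Proof.
move=> u0 fin e0; have ue0 n : (0 <= (u n)%:E)%E by rewrite lee_fin.
have := nneseries_tail_cvg fin (fun n _ => ue0 n).
move=> /fine_cvgP[[N1 _ H1] /cvgrPdist_lt/(_ _ e0)[N2 _ H2]].
exists (maxn N1 N2) => n Nn; apply: (@le_trans _ _ (fine (\sum_(n <= k <oo) (u k)%:E)%E)).
  rewrite -lee_fin fineK; last by apply: H1; rewrite /= (leq_trans _ Nn)// leq_maxl.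
  apply: le_trans (nneseries_lim_ge n.+1 _) => //.
  by rewrite big_nat1.
have /= := H2 n (leq_trans (leq_maxr _ _) Nn); rewrite sub0r normrN => /ltW.
by apply: le_trans; exact: ler_norm.
Qed.

Section hausdorff_basics.
Variables (R : realType) (f : R -> R).
Hypothesis f_dim : dimension_function f.
Local Notation mu := (@lebesgue_measure R).
Implicit Types (A B U : set R) (c l : nat -> R).

Lemma dimension_function_gt0 x : 0 < x -> 0 < f x.
Proof. by move=> x0; case: f_dim => + _ _ _; apply; rewrite in_itv/= x0. Qed.

Lemma dimension_function_le x y : 0 < x -> x <= y -> f x <= f y.
Proof.
case: f_dim => _ _ + _ => fnd x0 xy; apply: fnd => //; rewrite in_itv/= andbT//.
exact: lt_le_trans xy.
Qed.

Lemma dimf0_ge0 x : 0 <= x -> 0 <= dimf0 f x.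
Proof.
rewrite /dimf0 le_eqVlt => /predU1P[<-|x0]; first by rewrite eqxx.
by rewrite gt_eqF// ltW// dimension_function_gt0.
Qed.

Lemma dimf0_le x y : 0 <= x -> x <= y -> dimf0 f x <= dimf0 f y.
Proof.
rewrite le_eqVlt => /predU1P[<-|x0] xy; first by rewrite {1}/dimf0 eqxx dimf0_ge0.
by rewrite /dimf0 !gt_eqF ?(lt_le_trans x0)// dimension_function_le.
Qed.

Lemma dimension_function_right_approx d e : 0 <= d -> 0 < e ->
  exists t, [/\ d < t, t <= d + e & f t <= dimf0 f d + e].
Proof.
move=> d0 e0; have [_ fc _ f0] := f_dim.
suff [r r0 H] : exists2 r, 0 < r & forall t, d < t -> t < d + r -> f t <= dimf0 f d + e.
  exists (d + Num.min e (r / 2)); have m0 : 0 < Num.min e (r / 2) by rewrite lt_min e0 divr_gt0.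
  split; [by rewrite ltrDl| by rewrite lerD2l ge_min lexx|].
  apply: H; rewrite ?ltrDl// ltrD2l gt_min; apply/orP; right.
  by rewrite ltr_pdivrMr// ltr_pMr// ltr1n.
move: d0; rewrite le_eqVlt => /predU1P[<-|d0].
  have /cvgrPdist_lt/(_ _ e0) [r /= r0 H] := f0.
  exists r => // t t0; rewrite add0r => tr; rewrite /dimf0 eqxx add0r.
  have /= := H t; rewrite sub0r normrN gtr0_norm// => /(_ tr t0).
  by rewrite sub0r normrN => /ltW; apply: le_trans; exact: ler_norm.
have dP : d \in `]0, +oo[ by rewrite in_itv/= d0.
have /cvgrPdist_lt/(_ _ e0) [r /= r0 H] := fc _ dP.
exists r => // t dt tr; rewrite /dimf0 gt_eqF//.
have /= := H t; rewrite distrC gtr0_norm ?subr_gt0// ltrBlDl => /(_ tr).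
by rewrite distrC => /ltW; rewrite -lerBlDl; apply: le_trans; exact: ler_norm.
Qed.

Lemma diam_ge0 U : (0 <= diam U)%E.
Proof. by rewrite /diam le_max lexx. Qed.

Lemma diam_le U (d : R) : 0 <= d -> (forall x y, U x -> U y -> `|x - y| <= d) ->
  (diam U <= d%:E)%E.
Proof.
move=> d0 H; rewrite /diam ge_max lee_fin d0/=.
by apply: ge_ereal_sup => _ [[x y] [/= Ux Uy] <-]; rewrite lee_fin H.
Qed.

Lemma diam_itv (a l : R) : 0 <= l -> (diam `[a, (a + l)%R]%classic <= l%:E)%E.
Proof.
move=> l0; apply: diam_le => // x y /=; rewrite !in_itv/= => /andP[? ?] /andP[? ?].
by rewrite ler_norml; apply/andP; split; lra.
Qed.

Lemma diam_sub_itv U (d : R) : (diam U <= d%:E)%E -> exists a : R, U `<=` `[a, (a + d)%R].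
Proof.
move=> Ud; have [[x0 Ux0]|/forallNP H] := pselect (exists x, U x); last first.
  by exists 0 => x /H.
have xy x y : U x -> U y -> x - y <= d.
  move=> Ux Uy; rewrite -lee_fin; apply: le_trans Ud; rewrite /diam le_max; apply/orP; right.
  apply: (@le_trans _ _ `|x - y|%:E); first by rewrite lee_fin ler_norm.
  by apply: ereal_sup_ubound; exists (x, y).
have Ulb : has_lbound U by exists (x0 - d) => y Uy; rewrite lerBlDr -lerBlDl xy.
exists (inf U) => x Ux /=; rewrite in_itv/= ge_inf//=.
rewrite -lerBlDr; apply: lb_le_inf; first by exists x0.
by move=> y Uy; rewrite lerBlDr -lerBlDl xy.
Qed.

Let fdiam_ge0 U : (0 <= (dimf0 f (fine (diam U)))%:E)%E.
Proof. by rewrite lee_fin dimf0_ge0// fine_ge0// diam_ge0. Qed.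

Lemma hausdorff_content_ge0 d A : (0 <= hausdorff_content f d A)%E.
Proof.
by apply: le_ereal_inf_tmp => _ [U _ <-]; apply: nneseries_ge0.
Qed.

Lemma hausdorff_measure_ge0 A : (0 <= hausdorff_measure f A)%E.
Proof.
apply: le_trans (hausdorff_content_ge0 1 A) _.
by apply: ereal_sup_ubound; exists 1 => //=; exact: ltr01.
Qed.

Lemma le_hausdorff_measure A B : A `<=` B ->
  (hausdorff_measure f A <= hausdorff_measure f B)%E.
Proof.
move=> AB; apply: ge_ereal_sup => _ [d d0 <-].
apply: le_trans (_ : hausdorff_content f d B <= _)%E; last first.
  by apply: ereal_sup_ubound; exists d.
apply: ereal_inf_le_tmp => _ [U [BU Ud] <-]; exists U => //; split => //.
exact: subset_trans BU.
Qed.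

Lemma hausdorff_measure_le (M : \bar R) A :
  (forall d e : R, 0 < d -> 0 < e -> exists U : nat -> set R,
    [/\ A `<=` \bigcup_i U i, forall i, (diam (U i) <= d%:E)%E &
        (\sum_(0 <= i <oo) (dimf0 f (fine (diam (U i))))%:E <= M + e%:E)%E]) ->
  (hausdorff_measure f A <= M)%E.
Proof.
move=> H; apply: ge_ereal_sup => _ [d d0 <-].
apply/lee_addgt0Pr => e e0.
have [U [AU Ud UM]] := H d e d0 e0.
by apply: le_trans UM; apply: ereal_inf_lbound; exists U.
Qed.

Lemma hausdorff_measure_cover (M d : R) A : 0 < d ->
  (hausdorff_measure f A < M%:E)%E -> exists U : nat -> set R,
    [/\ A `<=` \bigcup_i U i, forall i, (diam (U i) <= d%:E)%E &
        (\sum_(0 <= i <oo) (dimf0 f (fine (diam (U i))))%:E <= M%:E)%E].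
Proof.
move=> d0 AM.
have : (hausdorff_content f d A < M%:E)%E.
  by apply: le_lt_trans AM; apply: ereal_sup_ubound; exists d.
by move=> /ereal_inf_lt[_ [U [AU Ud] <-] /ltW UM]; exists U.
Qed.

Lemma hausdorff_measureU0 A B : hausdorff_measure f B = 0%E ->
  (hausdorff_measure f (A `|` B) <= hausdorff_measure f A)%E.
Proof.
move=> B0; have [->|] := eqVneq (hausdorff_measure f A) +oo%E; first by rewrite leey.
move=> Afin; have {}Afin : hausdorff_measure f A \is a fin_num.
  by rewrite ge0_fin_numE ?hausdorff_measure_ge0// ltey.
apply: hausdorff_measure_le => d e d0 e0.
have e20 : 0 < e / 2 by rewrite divr_gt0.
have [U [AU Ud UM]] : exists U : nat -> set R,
    [/\ A `<=` \bigcup_i U i, forall i, (diam (U i) <= d%:E)%E &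
        (\sum_(0 <= i <oo) (dimf0 f (fine (diam (U i))))%:E <=
          (fine (hausdorff_measure f A) + e / 2)%:E)%E].
  apply: hausdorff_measure_cover => //.
  by rewrite EFinD fineK// lteDl// lte_fin.
have B2 : (hausdorff_measure f B < (e / 2)%:E)%E by rewrite B0 lte_fin.
have [V [BV Vd VM]] := hausdorff_measure_cover d0 B2.
exists (fun i => if odd i then V i./2 else U i./2); split.
- move=> x [/AU[i _ Ui]|/BV[i _ Vi]]; [exists i.*2|exists i.*2.+1] => //.
    by rewrite odd_double doubleK.
  by rewrite /= odd_double uphalf_double.
- by move=> i; case: ifP.
- set u := fun i => (dimf0 f (fine (diam (U i))))%:E.
  set v := fun i => (dimf0 f (fine (diam (V i))))%:E.
  apply: lime_le; first by apply: is_cvg_nneseries.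
  apply: nearW => n.
  apply: (@le_trans _ _ (\sum_(0 <= i < n) (u i + v i))%E).
    apply: (@le_trans _ _ (\sum_(0 <= i < n.*2)
      (dimf0 f (fine (diam (if odd i then V i./2 else U i./2))))%:E)%E).
      rewrite [leRHS](@big_cat_nat _ _ _ n)//=; last by rewrite -addnn leq_addr.
      by rewrite leeDl// sume_ge0.
    elim: n => [|n IH]; first by rewrite !big_geq.
    rewrite doubleS !big_nat_recr//= -addeA leeD//.
    by rewrite odd_double doubleK /= uphalf_double.
  rewrite big_split/=.
  apply: (@le_trans _ _ (\sum_(0 <= i <oo) u i + \sum_(0 <= i <oo) v i)%E).
    by apply: leeD; apply: nneseries_lim_ge => k _ _; exact: fdiam_ge0.
  apply: (le_trans (leeD UM VM)).
  by rewrite -EFinD -addrA -splitr EFinD fineK.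
Qed.

Lemma hausdorff_measure_setU_eq0 A B : hausdorff_measure f A = 0%E ->
  hausdorff_measure f B = 0%E -> hausdorff_measure f (A `|` B) = 0%E.
Proof.
move=> A0 B0; apply/eqP; rewrite eq_le hausdorff_measure_ge0 andbT -A0.
exact: hausdorff_measureU0.
Qed.

Lemma hausdorff_measure_set0 : hausdorff_measure f set0 = 0%E.
Proof.
apply/eqP; rewrite eq_le hausdorff_measure_ge0 andbT.
apply: hausdorff_measure_le => d e d0 e0; exists (fun=> set0); split => //.
  by move=> i; apply: diam_le => //; exact: ltW.
have -> : diam (set0 : set R) = 0%E.
  by apply/eqP; rewrite eq_le diam_ge0 andbT; exact: diam_le.
by rewrite /dimf0/= eqxx eseries0// add0e lee_fin ltW.
Qed.

Lemma hausdorff_limsup_itv0 c l : (forall n, 0 <= l n) ->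
  (\sum_(0 <= n <oo) (dimf0 f (l n))%:E < +oo)%E ->
  hausdorff_measure f
    [set x | infinite_set [set n | c n <= x <= c n + l n]] = 0%E.
Proof.
move=> l0 fin; apply/eqP; rewrite eq_le hausdorff_measure_ge0 andbT.
have u0 n : (0 <= (dimf0 f (l n))%:E)%E by rewrite lee_fin dimf0_ge0.
apply: hausdorff_measure_le => d e d0 e0.
have := nneseries_tail_cvg fin (fun n _ => u0 n).
move=> /fine_cvgP[[N1 _ H1] /cvgrPdist_lt/(_ _ e0)[N2 _ H2]].
have fd2 : 0 < f d / 2 by rewrite divr_gt0// dimension_function_gt0.
have [N3 H3] := nneseries_small (fun n => dimf0_ge0 (l0 n)) fin fd2.
pose N := maxn (maxn N1 N2) N3.
have tailN : (\sum_(N <= n <oo) (dimf0 f (l n))%:E <= e%:E)%E.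
  have /fineK <- : (\sum_(N <= n <oo) (dimf0 f (l n))%:E)%E \is a fin_num.
    by apply: H1; rewrite /= /N !leq_max leqnn.
  have /= := H2 N; rewrite /N !leq_max leqnn orbT => /(_ isT).
  by rewrite sub0r normrN lee_fin => /ltW; apply: le_trans; exact: ler_norm.
have ld n : (N <= n)%N -> l n <= d.
  move=> Nn; rewrite leNgt; apply/negP => dl.
  have := H3 n (leq_trans (leq_maxr _ _) Nn); rewrite /dimf0 gt_eqF ?(lt_trans d0)//.
  have := dimension_function_le d0 (ltW dl); have := dimension_function_gt0 d0; lra.
exists (fun i => `[c (i + N)%N, (c (i + N)%N + l (i + N)%N)%R]%classic); split.
- move=> x /infinite_set_natP /(_ N)[n Nn /= h].
  by exists (n - N)%N => //=; rewrite subnK// in_itv.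
- move=> i; apply: le_trans (diam_itv _ _) _ => //.
  by rewrite lee_fin ld// leq_addl.
- rewrite add0e; apply: le_trans tailN.
  rewrite -(nneseries_addn N u0); apply: lee_nneseries => // i _.
  rewrite lee_fin dimf0_le// ?fine_ge0 ?diam_ge0//.
  have dl := diam_itv (c (i + N)%N) (l0 (i + N)%N).
  by rewrite -lee_fin fineK// ge0_fin_numE ?diam_ge0// (le_lt_trans dl)// ltry.
Qed.

Lemma hausdorff_measure_negligible (C : R) A :
  (forall x, 0 < x -> x <= 1 -> f x <= C * x) ->
  mu.-negligible A -> hausdorff_measure f A = 0%E.
Proof.
move=> fC /negligible_outer_measure A0.
have C0 : 0 < C.
  by have := fC 1 ltr01 (lexx _); rewrite mulr1; apply: lt_le_trans; exact: dimension_function_gt0.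
apply/eqP; rewrite eq_le hausdorff_measure_ge0 andbT.
apply: hausdorff_measure_le => d e d0 e0; rewrite add0e.
pose eta := Num.min 1 (Num.min d (e / C)).
have eta0 : 0 < eta by rewrite !lt_min ltr01 d0 divr_gt0.
have : (mu_ext (wlength (@idfun R)) A < eta%:E)%E by rewrite A0.
move=> /ereal_inf_lt[_ [F [Foc AF] <-] Feta].
have Fl i : exists l : R, [/\ 0 <= l, (diam (F i) <= l%:E)%E & wlength (@idfun R) (F i) = l%:E].
  have /ocitvP[->|[[a b] /= ab ->]] := Foc i.
    by exists 0; rewrite wlength0; split => //; apply: diam_le.
  exists (b - a); split; first by rewrite subr_ge0 ltW.
    apply: diam_le; first by rewrite subr_ge0 ltW.
    move=> x y /=; rewrite !in_itv/= => /andP[? ?] /andP[? ?].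
    by rewrite ler_norml; apply/andP; split; lra.
  by rewrite wlength_itv/= lte_fin ab.
have [l lP] := choice Fl.
have l0 i : 0 <= l i by case: (lP i).
have leta i : l i <= eta.
  rewrite -lee_fin; apply: le_trans (ltW Feta).
  rewrite (eq_eseriesr (g := fun i => (l i)%:E)); last by move=> j _; case: (lP j).
  apply: le_trans (nneseries_lim_ge i.+1 _); last by move=> *; rewrite lee_fin.
  by rewrite big_nat_recr//= leeDr// sume_ge0// => *; rewrite lee_fin.
have el1 i : l i <= 1 by apply: le_trans (leta i) _; rewrite ge_min lexx.
exists F; split => //.
  move=> i; have [_ Fd _] := lP i; apply: le_trans Fd _; rewrite lee_fin.
  by apply: le_trans (leta i) _; rewrite !ge_min lexx orbT.
apply: (@le_trans _ _ (\sum_(0 <= i <oo) (C%:E * (l i)%:E))%E).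
  apply: lee_nneseries => // i _; rewrite -EFinM lee_fin.
  have [_ Fd _] := lP i.
  have {}Fd : fine (diam (F i)) <= l i.
    by rewrite -lee_fin fineK// ge0_fin_numE ?diam_ge0// (le_lt_trans Fd)// ltry.
  apply: le_trans (dimf0_le _ Fd) _; first by rewrite fine_ge0// diam_ge0.
  rewrite /dimf0; case: eqP => [->|/eqP ln0]; first by rewrite mulr0.
  by apply: fC => //; rewrite lt_neqAle eq_sym ln0 l0.
rewrite nneseriesZl; last by move=> i _; rewrite lee_fin.
rewrite (eq_eseriesr (g := fun i => wlength (@idfun R) (F i))); last first.
  by move=> i _; case: (lP i) => _ _ ->.
apply: (@le_trans _ _ (C%:E * eta%:E)%E).
  by rewrite lee_pmul2l ?lte_fin// ltW.
rewrite -EFinM lee_fin mulrC -ler_pdivlMr//.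
by rewrite !ge_min lexx !orbT.
Qed.

Lemma hausdorff_finite_ball_cover A : (hausdorff_measure f A < +oo)%E ->
  exists M : R, forall d : R, 0 < d -> exists c s : nat -> R,
    [/\ forall i, 0 < s i <= d,
        forall m, \sum_(i < m) f (2 * s i) <= M &
        A `<=` \bigcup_i ball (c i) (s i)].
Proof.
move=> Afin.
have {}Afin : hausdorff_measure f A \is a fin_num.
  by rewrite ge0_fin_numE ?hausdorff_measure_ge0.
exists (fine (hausdorff_measure f A) + 1 + 2) => d d0.
have [U [AU Ud UM]] : exists U : nat -> set R,
    [/\ A `<=` \bigcup_i U i, forall i, (diam (U i) <= d%:E)%E &
        (\sum_(0 <= i <oo) (dimf0 f (fine (diam (U i))))%:E <=
          (fine (hausdorff_measure f A) + 1)%:E)%E].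
  apply: hausdorff_measure_cover => //.
  by rewrite EFinD fineK// lteDl.
pose w i := fine (diam (U i)).
have Uw i : diam (U i) = (w i)%:E.
  by rewrite fineK// ge0_fin_numE ?diam_ge0// (le_lt_trans (Ud i))// ltry.
have w0 i : 0 <= w i by rewrite fine_ge0// diam_ge0.
have H i : exists cs : R * R, [/\ 0 < cs.2, cs.2 <= d,
    f (2 * cs.2) <= dimf0 f (w i) + 2^-1 ^+ i & U i `<=` ball cs.1 cs.2].
  have e0 : 0 < Num.min d (2^-1 ^+ i) by rewrite lt_min d0 exprn_gt0.
  have [t [wt te fte]] := dimension_function_right_approx (w0 i) e0.
  have [a Ua] := @diam_sub_itv (U i) (w i) (ltac:(by rewrite Uw)).
  have wd : w i <= d by rewrite -lee_fin -Uw.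
  have td : t <= w i + d by apply: le_trans te _; rewrite lerD2l ge_min lexx.
  exists (a + w i / 2, t / 2); split => /=.
  - by rewrite divr_gt0// (le_lt_trans _ wt).
  - lra.
  - rewrite mulrC divfK//; apply: le_trans fte _.
    by rewrite lerD2l ge_min lexx orbT.
  - move=> x /Ua /=; rewrite in_itv/= => /andP[h1 h2]; rewrite /ball/= ltr_norml.
    by apply/andP; split; lra.
have [cs csP] := choice H.
exists (fst \o cs), (snd \o cs); split.
- by move=> i; have [h1 h2 _ _] := csP i; rewrite /= h1.
- move=> m; apply: (@le_trans _ _ (\sum_(i < m) (dimf0 f (w i) + 2^-1 ^+ i))).
    by apply: ler_sum => i _; case: (csP i).
  rewrite big_split/=; apply: lerD.
    rewrite -lee_fin -sumEFin; apply: le_trans UM.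
    apply: le_trans (nneseries_lim_ge m _); first by rewrite big_mkord.
    by move=> k _ _; exact: fdiam_ge0.
  suff -> : \sum_(i < m) (2^-1 ^+ i : R) = 2 - 2 * 2^-1 ^+ m.
    by rewrite lerBlDr lerDl mulr_ge0// exprn_ge0.
  elim: m => [|m IH]; first by rewrite big_ord0 expr0; lra.
  by rewrite big_ord_recr/= IH exprS; field.
- move=> x /AU[i _ Ux]; exists i => //; have [_ _ _ h] := csP i; exact: h.
Qed.

End hausdorff_basics.

Section real_lemmas.
Variable R : realType.
Local Notation mu := (@lebesgue_measure R).

Lemma bounded_series_tail (u : nat -> R) (M e : R) : (forall i, 0 <= u i) ->
  (forall m, \sum_(i < m) u i <= M) -> 0 < e ->
  exists k, forall m, \sum_(i < m | (k <= i)%N) u i <= e.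
Proof.
move=> u0 uM e0; pose S := [set \sum_(i < m) u i | m in [set: nat]].
have supS : has_sup S.
  by split; [exists (\sum_(i < 0) u i), 0%N|exists M => _ [m _ <-]].
have [_ [k _ <-] h] := sup_adherent e0 supS; exists k => m.
have [mk|/ltnW km] := leqP m k.
  rewrite big1 ?ltW// => i ki; have := leq_trans (leq_trans (ltn_ord i) mk) ki.
  by rewrite ltnn.
have : \sum_(i < m) u i <= sup S by apply: ub_le_sup; [case: supS|exists m].
rewrite (bigID (fun i : 'I_m => (i < k)%N))/=.
have -> : \sum_(i < m | (i < k)%N) u i = \sum_(i < k) u i.
  by rewrite [RHS](big_ord_widen m u km).
have -> : \sum_(i < m | ~~ (i < k)%N) u i = \sum_(i < m | (k <= i)%N) u i.
  by apply: eq_bigl => i; rewrite -leqNgt.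
lra.
Qed.

Lemma measure_bigcup_ball_le (c s : nat -> R) (Q : pred nat) (K e : R) :
  (forall i, 0 <= s i) -> 0 <= K ->
  (forall m, \sum_(i < m | Q i) s i <= e) ->
  (mu (\bigcup_(i in [set i | Q i]) ball (c i) (K * s i)) <= (2 * K * e)%:E)%E.
Proof.
move=> s0 K0 se.
pose F i := if Q i then ball (c i) (K * s i) else set0.
have -> : \bigcup_(i in [set i | Q i]) ball (c i) (K * s i) = \bigcup_i F i.
  apply/seteqP; split => x [i].
    by move=> /= Qi h; exists i => //; rewrite /F Qi.
  by rewrite /F; case: ifP => // Qi _ h; exists i.
have mF i : measurable (F i) by rewrite /F; case: ifP => // _; exact: measurable_ball.
apply: le_trans (measure_sigma_subadditive mu mF (bigcupT_measurable _ mF) _) _ => //.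
apply: lime_le; first by apply: is_cvg_nneseries.
apply: nearW => m; rewrite big_mkord.
apply: (@le_trans _ _ (\sum_(i < m) (if Q i then 2 * K * s i else 0)%:E)%E).
  apply: lee_sum => i _; rewrite /F; case: ifP => _; last by rewrite measure0.
  rewrite [leLHS]lebesgue_measure_ball ?mulr_ge0// lee_fin mulr2n; lra.
rewrite sumEFin lee_fin -big_mkcond/= -mulr_sumr.
by apply: ler_wpM2l; [rewrite mulr_ge0|exact: se].
Qed.

Lemma measure_bigcup_le (F : nat -> set R) (b : \bar R) :
  (forall n, measurable (F n)) ->
  (forall n, (mu (\bigcup_(i in `I_n) F i) <= b)%E) -> (mu (\bigcup_i F i) <= b)%E.
Proof.
move=> mF H.
pose G n := \bigcup_(i in `I_n) F i.
have mG n : measurable (G n) by apply: bigcup_measurable => i _; exact: mF.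
have -> : \bigcup_i F i = \bigcup_n G n.
  apply/seteqP; split => x; first by move=> [i _ h]; exists i.+1 => //; exists i => //=.
  by move=> [n _ [i _ h]]; exists i.
have ndG : nondecreasing_seq G.
  move=> m n mn; apply/subsetPset => x [i /= im h]; exists i => //=.
  exact: leq_trans mn.
have cv := nondecreasing_cvg_mu (mu := mu) mG (bigcupT_measurable _ mG) ndG.
rewrite -(cvg_lim _ cv)//; apply: lime_le; first by apply/cvg_ex; eexists; exact: cv.
by apply: nearW => n; exact: H.
Qed.

End real_lemmas.

Section mass_transference.
Variables (R : realType) (f : R -> R).
Hypothesis f_dim : dimension_function f.
Hypothesis f_noninc :
  {in `]0, +oo[ &, {homo (fun x : R => x^-1 * f x) : x y / x <= y >-> y <= x}}.
Hypothesis f_unbounded : forall L : R, exists2 d : R, 0 < d &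
  forall x, 0 < x -> x <= d -> L * x <= f x.
Local Notation mu := (@lebesgue_measure R).

Let f_ratio (x y : R) : 0 < x -> x <= y -> x * f y <= y * f x.
Proof.
move=> x0 xy; have y0 : 0 < y := lt_le_trans x0 xy.
have := f_noninc (x := x) (y := y); rewrite !in_itv/= x0 y0 => /(_ isT isT xy).
move=> /(ler_wpM2l (ltW (mulr_gt0 x0 y0))).
rewrite [leLHS](_ : _ = x * f y); last by field; rewrite gt_eqF.
by rewrite [leRHS](_ : _ = y * f x)//; field; rewrite gt_eqF.
Qed.

Section step.
(* [hit z rho i]: the covering interval [ball (c i) (s i)] meets [z - rho, z + rho].
   [light z rho]: the covering intervals that meet it are short in total; since
   1/16 < 1, none of them contains [z - rho, z + rho]. *)
Variables (x r : nat -> R).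
Hypothesis r_cvg0 : forall e, 0 < e -> exists N, forall n, (N <= n)%N -> r n <= e.
Hypothesis full : mu.-negligible (`[0, 1]%classic `\`
  [set y | forall N, exists2 n, (N <= n)%N & 0 < r n /\ `|y - x n| < f (r n)]).
Variables (c s : nat -> R) (M : R).
Hypothesis s_gt0 : forall i, 0 < s i.
Hypothesis sM : forall m, \sum_(i < m) f (2 * s i) <= M.

Let hit (z rho : R) : pred nat := fun i => `|c i - z| < s i + rho.

Let light (z rho : R) := forall m, \sum_(i < m | hit z rho i) s i <= rho / 16.

Let f_pos u : 0 < u -> 0 < f u. Proof. exact: dimension_function_gt0. Qed.

Let f2s_ge0 i : 0 <= f (2 * s i). Proof. by rewrite ltW// f_pos// mulr_gt0. Qed.

Let not_light_sum z rho : 0 < rho -> ~ light z rho ->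
  exists m, f (2 * rho) / 16 <= \sum_(i < m | hit z rho i) f (2 * s i).
Proof.
move=> r0 /existsNP[m /negP]; rewrite -ltNge => h; exists m.
have [[i [hi ri]]|/forallNP no] := pselect (exists i : 'I_m, hit z rho i /\ rho <= s i).
  rewrite (bigD1 i)//=.
  apply: (@le_trans _ _ (f (2 * s i))).
    apply: (@le_trans _ _ (f (2 * rho))); last first.
      by apply: (dimension_function_le f_dim); rewrite ?mulr_gt0// ler_pM2l.
    have := f_pos (mulr_gt0 (ltr0n _ 2) r0 : 0 < 2 * rho); lra.
  by rewrite lerDl sumr_ge0.
have f2r := f_pos (mulr_gt0 (ltr0n _ 2) r0 : 0 < 2 * rho).
apply: (@le_trans _ _ (\sum_(i < m | hit z rho i) s i * (f (2 * rho) / rho))).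
  rewrite -mulr_suml mulrA ler_pdivlMr// -[leLHS]mulrA mulrC.
  rewrite [leLHS](_ : _ = rho / 16 * f (2 * rho)); last by field.
  by rewrite ler_pM2r// ltW.
apply: ler_sum => i hi; rewrite mulrA ler_pdivrMr//.
have : s i < rho by rewrite ltNge; apply/negP => ri; exact: (no i).
have := @f_ratio (2 * s i) (2 * rho) (mulr_gt0 (ltr0n _ 2) (s_gt0 i)).
move=> + sr; rewrite ler_pM2l// => /(_ (ltW sr)).
rewrite -!mulrA ler_pM2l// (mulrC rho); lra.
Qed.

(* Otherwise a Vitali family of balls of radius f (r n), centred at the x n, fills a
   fixed proportion of the interval away from the enlarged covering intervals, and
   each of its smaller balls of radius r n / 2 is heavy. The intervals which meet
   these small balls are then distinct for distinct balls and of arbitrarily large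
   index, so the tail of the sum of the f (2 * s i) cannot be small. *)
Lemma avoidance_step z rho N : 0 < rho -> 0 <= z - rho -> z + rho <= 1 ->
  light z rho -> exists n,
  [/\ (N <= n)%N, 0 < r n, `|x n - z| + r n / 2 <= rho & light (x n) (r n / 2)].
Proof.
move=> rho0 zl zr lz; apply: contrapT => /forallNP none.
have [I tailI] := bounded_series_tail f2s_ge0 sM (divr_gt0 rho0 (ltr0n _ 1000) : 0 < rho / 1000).
have [eta eta0 etas] : exists2 eta, 0 < eta & forall i, (i < I)%N -> eta <= s i.
  elim: (I) => [|k [eta eta0 h]]; first by exists 1.
  exists (Num.min eta (s k)); first by rewrite lt_min eta0 s_gt0.
  move=> i; rewrite ltnS leq_eqVlt => /predU1P[->|/h]; rewrite ge_min ?lexx ?orbT// => ->//.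
have [N1 [NN1 HN1]] : exists N1, (N <= N1)%N /\ forall n, (N1 <= n)%N -> 0 < r n ->
    [/\ r n <= f (r n), f (r n) <= rho / 8 & f (r n) <= eta].
  have m0 : 0 < Num.min (rho / 8) eta by rewrite lt_min eta0 divr_gt0.
  have [t [t0 _]] := dimension_function_right_approx f_dim (lexx 0) m0.
  rewrite /dimf0 eqxx add0r le_min => /andP[ft1 ft2].
  have [d d0 dP] := f_unbounded 1.
  have [N1 HN1] : exists N1, forall n, (N1 <= n)%N -> r n <= Num.min t d.
    by apply: r_cvg0; rewrite lt_min t0.
  exists (maxn N N1); split; first exact: leq_maxl.
  move=> n /(leq_trans (leq_maxr _ _)) /HN1; rewrite le_min => /andP[rt rd] rn0.
  have frt := dimension_function_le f_dim rn0 rt.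
  by split; [rewrite -[leLHS]mul1r dP|exact: le_trans ft1|exact: le_trans ft2].
pose Z := \bigcup_(i in [set i | hit z rho i]) ball (c i) (4 * s i).
pose J := `[z - rho / 2, z + rho / 2]%classic.
pose V n := [/\ (N1 <= n)%N, 0 < r n &
   exists y, [/\ J y, ~ Z y & `|y - x n| < f (r n)]].
have muZ : (mu Z <= (rho / 2)%:E)%E.
  apply: le_trans (measure_bigcup_ball_le c _ _ (lz)) _ => //; first by move=> i; exact: ltW.
  by rewrite lee_fin; lra.
have VJ n : V n -> `|x n - z| + r n / 2 <= rho.
  move=> [nN rn0 [y [Jy _ yx]]]; have [h1 h2 _] := HN1 n nN rn0.
  move: Jy; rewrite /J/= in_itv/= => /andP[y1 y2].
  suff : `|x n - z| <= rho - r n / 2 by lra.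
  move: yx; rewrite ltr_norml ler_norml => /andP[y3 y4]; apply/andP; split; lra.
have Vhit n i : V n -> hit (x n) (r n / 2) i -> (I <= i)%N /\ `|x n - c i| < f (r n).
  move=> Vn; have VJn := VJ n Vn; case: Vn => nN rn0 [y [Jy nZ yx]].
  have [h1 h2 h3] := HN1 n nN rn0; rewrite /hit => hi.
  have hz : hit z rho i.
    rewrite /hit -(subrKA (x n)); apply: le_lt_trans (ler_normD _ _) _; lra.
  have yc : 4 * s i <= `|c i - y|.
    rewrite leNgt; apply/negP => yc; apply: nZ; exists i => //.
  have tri : `|c i - y| <= `|c i - x n| + `|y - x n|.
    by rewrite -(subrKA (x n) (c i)) (distrC y); exact: ler_normD.
  have si := s_gt0 i.
  split; last by rewrite distrC; lra.
  by rewrite leqNgt; apply/negP => /etas; lra.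
pose F n := if `[< V n >] then ball (x n) (f (r n)) else set0.
have mF n : measurable (F n) by rewrite /F; case: ifP => // _; exact: measurable_ball.
have lower : (rho%:E <= (rho / 2)%:E + mu (\bigcup_i F i))%E.
  have [Neg [mNeg Neg0 subNeg]] := full.
  have mZ : measurable Z by apply: bigcup_measurable => i _; exact: measurable_ball.
  have mUF : measurable (\bigcup_i F i) by exact: bigcupT_measurable.
  have JU : J `<=` (Z `|` Neg) `|` \bigcup_i F i.
    move=> y Jy; have [Zy|nZy] := pselect (Z y); first by left; left.
    have [Ny|nNy] := pselect (Neg y); first by left; right.
    right; have : forall N0, exists2 n, (N0 <= n)%N & 0 < r n /\ `|y - x n| < f (r n).
      apply: contrapT => nl; apply: nNy; apply: subNeg; split => //.
      by move: Jy; rewrite /J/= !in_itv/= => /andP[? ?]; apply/andP; split; lra.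
    move=> /(_ N1)[n nN [rn0 yx]]; exists n => //.
    by rewrite /F asboolT; [rewrite /ball/= distrC|split => //; exists y].
  have -> : rho%:E = mu J.
    rewrite /J lebesgue_measure_itv/= lte_fin ifT; last by lra.
    by rewrite -EFinB; congr (_%:E); lra.
  apply: (@le_trans _ _ (mu ((Z `|` Neg) `|` \bigcup_i F i))).
    by apply: le_measure; rewrite ?inE//; [exact: measurable_itv|do 2?[apply: measurableU => //]].
  apply: le_trans (measureU2 _ _ _) _ => //; first exact: measurableU.
  rewrite leeD2r//; apply: le_trans (measureU2 _ _ _) _ => //.
  by rewrite -[leRHS]adde0; apply: leeD; [exact: muZ|rewrite -Neg0; exact: lexx].
have upper : (mu (\bigcup_i F i) <= (rho / 10)%:E)%E.
  apply: measure_bigcup_le => // k.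
  pose B n : set R := if 0 < r n then ball (x n) (f (r n)) else ball 0 1.
  have BV n : V n -> B n = ball (x n) (f (r n)) by move=> [_ rn _]; rewrite /B rn.
  have ballB n : is_ball (B n) by rewrite /B; case: ifP => _; exact: is_ball_ball.
  have B0 n : B n !=set0.
    rewrite /B; case: ifP => [rn|_]; [exists (x n)|exists 0]; apply: ballxx => //.
    exact: f_pos.
  pose S := [seq n <- iota 0 k | `[< V n >]].
  have [D [uD DS tD SD]] := vitali_lemma_finite_cover ballB B0 S.
  have DV n : n \in D -> V n by move=> /DS; rewrite mem_filter => /andP[/asboolP].
  have bigD : (mu (\bigcup_(i in `I_k) F i) <= (\sum_(n <- D) 6 * f (r n))%:E)%E.
    have mC : measurable (\big[setU/set0]_(n <- D) ball (x n) (3 * f (r n))).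
      by apply: bigsetU_measurable => n _; exact: measurable_ball.
    apply: (@le_trans _ _ (mu (\big[setU/set0]_(n <- D) ball (x n) (3 * f (r n))))).
      apply: le_measure; rewrite ?inE//.
        by apply: bigcup_measurable => i _; exact: mF.
      move=> y [n /= nk]; rewrite /F; case: ifPn => // /asboolP Vn yB.
      have : cover [set` S] B y.
        exists n; last by rewrite BV.
        by rewrite /= mem_filter mem_iota add0n nk !andbT; exact/asboolP.
      move=> /SD[j /= jD]; rewrite (BV j (DV j jD)) scale_ballE// => yj.
      by rewrite -bigcup_seq; exists j.
    rewrite -sumEFin; elim: (D) DV => [|n D' IH] DV'.
      by rewrite !big_nil measure0.
    rewrite !big_cons; apply: le_trans (measureU2 _ _ _) _.
    - exact: measurable_ball.
    - by apply: bigsetU_measurable => j _; exact: measurable_ball.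
    apply: leeD; last by apply: IH => j jD; apply: DV'; rewrite inE jD orbT.
    have [_ rn _] := DV' n (mem_head _ _).
    have f3 : 0 <= 3 * f (r n) by have := f_pos rn; lra.
    by rewrite [leLHS]lebesgue_measure_ball// lee_fin mulr2n; lra.
  apply: le_trans bigD _; rewrite lee_fin -mulr_sumr.
  suff : \sum_(n <- D) f (r n) / 16 <= rho / 1000 by rewrite -mulr_suml; lra.
  have H n : exists m, n \in D ->
      f (r n) / 16 <= \sum_(i < m | hit (x n) (r n / 2) i) f (2 * s i).
    have [nD|nD] := boolP (n \in D); last by exists 0%N.
    have Vn := DV n nD; have [nN rn _] := Vn.
    have r20 : 0 < r n / 2 by rewrite divr_gt0.
    have [|m hm] := @not_light_sum (x n) (r n / 2) r20.
      move=> ln; apply: (none n); split => //; first exact: leq_trans nN.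
      exact: VJ.
    by exists m => _; rewrite (mulrC 2) divfK// in hm.
  have [m mP] := choice H.
  pose mm := \max_(n <- D) m n.
  apply: (@le_trans _ _ (\sum_(n <- D) \sum_(i < mm | hit (x n) (r n / 2) i) f (2 * s i))).
    rewrite big_seq [leRHS]big_seq; apply: ler_sum => n nD; apply: le_trans (mP n nD) _.
    have mle : (m n <= mm)%N by exact: (@leq_bigmax_seq _ _ xpredT).
    rewrite (big_ord_widen_cond mm (hit (x n) (r n / 2)) (fun i => f (2 * s i)) mle).
    rewrite [leRHS](bigID (fun i : 'I_mm => (i < m n)%N))/= lerDl.
    by apply: sumr_ge0.
  rewrite (exchange_big_dep xpredT)//=.
  apply: le_trans (tailI mm); rewrite [leRHS]big_mkcond/=; apply: ler_sum => i _.
  have [[n0 [n0D hn0]]|/forallNP nohit] := pselect (exists n, n \in D /\ hit (x n) (r n / 2) i).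
    have [Ii cn0] := Vhit n0 i (DV n0 n0D) hn0.
    rewrite Ii big_mkcond (bigD1_seq n0)//= hn0 big1_seq ?addr0// => n /andP[nn0 nD].
    case: ifP => // hn.
    have [_ cn] := Vhit n i (DV n nD) hn.
    move/eqP: nn0; case; apply: tD => //=; exists (c i).
    by rewrite (BV n (DV n nD)) (BV n0 (DV n0 n0D)).
  rewrite big1_seq; first by case: ifP => // _; exact: f2s_ge0.
  by move=> n /andP[hn nD]; exfalso; apply: (nohit n).
have := le_trans lower (leeD2l _ upper).
by rewrite -EFinD lee_fin; lra.
Qed.

Lemma avoidance : light 2^-1 2^-1 ->
  exists y, [/\ 0 <= y <= 1,
    forall N, exists2 n, (N <= n)%N & `|x n - y| < r n &
    ~ (\bigcup_i ball (c i) (s i)) y].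
Proof.
move=> light0.
pose Inv (p : R * R) := [/\ 0 < p.2, 0 <= p.1 - p.2, p.1 + p.2 <= 1 & light p.1 p.2].
have stepP (Np : nat * (R * R)) : exists n, Inv Np.2 ->
    [/\ (Np.1 <= n)%N, 0 < r n, `|x n - Np.2.1| + r n / 2 <= Np.2.2 &
        Inv (x n, r n / 2)].
  have [iP|niP] := pselect (Inv Np.2); last by exists 0%N.
  have [p0 pl pr pL] := iP.
  have [n [Nn rn xn ln]] := avoidance_step Np.1 p0 pl pr pL.
  exists n => _; split => //; split => //=; first by rewrite divr_gt0.
    by move: xn; have := ler_norm (Np.2.1 - x n); rewrite distrC; lra.
  by move: xn; have := ler_norm (x n - Np.2.1); lra.
have [nx nxP] := choice stepP.
pose p := fix p k := if k is k'.+1 then let n := nx (k', p k') in (x n, r n / 2)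
  else (2^-1, 2^-1) : R * R.
have pInv k : Inv (p k).
  elim: k => [|k IH]; first by split => //=; lra.
  by have [] := nxP (k, p k) IH.
have nested k : `|(p k.+1).1 - (p k).1| + (p k.+1).2 <= (p k).2.
  by have [] := nxP (k, p k) (pInv k).
have mono k j : (k <= j)%N -> `|(p j).1 - (p k).1| + (p j).2 <= (p k).2.
  move=> /subnKC <-; elim: (j - k)%N => [|i IH]; first by rewrite addn0 subrr normr0 add0r.
  have := nested (k + i)%N; rewrite addnS => h.
  have := ler_normD ((p (k + i).+1).1 - (p (k + i)%N).1) ((p (k + i)%N).1 - (p k).1).
  rewrite subrKA; lra.
pose S := [set (p k).1 - (p k).2 | k in [set: nat]].
have ubS j : ubound S ((p j).1 + (p j).2).
  move=> _ [k _ <-]; have [pj0 _ _ _] := pInv j; have [pk0 _ _ _] := pInv k.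
  have [/mono|/ltnW /mono] := leqP j k => h.
    have := ler_norm ((p k).1 - (p j).1); lra.
  have := ler_norm ((p k).1 - (p j).1); rewrite distrC; lra.
have S0 : S !=set0 by exists ((p 0%N).1 - (p 0%N).2), 0%N.
pose y := sup S.
have yp k : `|y - (p k).1| <= (p k).2.
  rewrite ler_distl; apply/andP; split.
    by apply: ub_le_sup; [exists ((p 0%N).1 + (p 0%N).2)|exists k].
  exact: ge_sup.
exists y; split.
- by have := yp 0%N; rewrite /= ler_norml; lra.
- move=> N; have [Nn rn _ _] := nxP (N, p N) (pInv N).
  exists (nx (N, p N)) => //; have := yp N.+1; rewrite /= distrC; lra.
- move=> [i _]; rewrite /ball/= => yi.
  have [N HN] := r_cvg0 (s_gt0 i).
  have [Nn rn _ [_ _ _ L]] := nxP (N, p N) (pInv N).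
  have yN := yp N.+1; rewrite /= in yN Nn rn L.
  set n := nx _ in yN Nn rn L.
  have hi : hit (x n) (r n / 2) i.
    by rewrite /hit -(subrKA y); apply: le_lt_trans (ler_normD _ _) _; lra.
  have := L i.+1; rewrite big_mkcond big_ord_recr/= hi.
  have : 0 <= \sum_(j < i) (if hit (x n) (r n / 2) j then s j else 0).
    by apply: sumr_ge0 => j _; case: ifP => // _; rewrite ltW.
  by have := HN n Nn; have := s_gt0 i; lra.
Qed.

End step.

Lemma mass_transference (x r : nat -> R) :
  (forall e, 0 < e -> exists N, forall n, (N <= n)%N -> r n <= e) ->
  mu.-negligible (`[0, 1]%classic `\`
    [set y | forall N, exists2 n, (N <= n)%N & 0 < r n /\ `|y - x n| < f (r n)]) ->
  hausdorff_measure f [set y | 0 <= y <= 1 /\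
    forall N, exists2 n, (N <= n)%N & `|x n - y| < r n] = +oo%E.
Proof.
move=> r0 full; apply/eqP; rewrite -leye_eq leNgt; apply/negP.
move=> /(hausdorff_finite_ball_cover f_dim)[M HM].
have M0 : 0 <= M by have [c [s [_ /(_ 0%N) + _]]] := HM 1 ltr01; rewrite big_ord0.
have [d d0 dP] := f_unbounded (16 * M + 1).
have [c [s [sd sM cov]]] := HM (d / 2) (divr_gt0 d0 (ltr0n _ 2)).
have s0 i : 0 < s i by have /andP[] := sd i.
suff L : forall m, \sum_(i < m | `|c i - 2^-1| < s i + 2^-1) s i <= 2^-1 / 16.
  by have [y [y01 yW yU]] := avoidance r0 full s0 sM L; exact/yU/cov.
move=> m.
have : \sum_(i < m) (16 * M + 1) * (2 * s i) <= M.
  apply: le_trans (sM m); apply: ler_sum => i _; have /andP[_ si] := sd i.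
  by apply: dP; rewrite ?mulr_gt0//; lra.
rewrite -mulr_sumr -mulr_sumr => h.
apply: (@le_trans _ _ (\sum_(i < m) s i)).
  rewrite [leRHS](bigID (fun i : 'I_m => `|c i - 2^-1| < s i + 2^-1))/= lerDl.
  by apply: sumr_ge0 => i _; rewrite ltW.
nra.
Qed.

Lemma full_measure_hausdorff_pinfty (A : set R) :
  mu.-negligible (`[0, 1]%classic `\` A) -> hausdorff_measure f A = +oo%E.
Proof.
move=> [Neg [mNeg Neg0 subNeg]]; apply/eqP; rewrite -leye_eq leNgt; apply/negP.
move=> /(hausdorff_finite_ball_cover f_dim)[M HM].
have M0 : 0 <= M by have [c [s [_ /(_ 0%N) + _]]] := HM 1 ltr01; rewrite big_ord0.
have [d d0 dP] := f_unbounded (2 * M + 1).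
have [c [s [sd sM cov]]] := HM (d / 2) (divr_gt0 d0 (ltr0n _ 2)).
have s0 i : 0 < s i by have /andP[] := sd i.
have sum_s m : \sum_(i < m | xpredT i) s i <= 1 / 4.
  have : \sum_(i < m) (2 * M + 1) * (2 * s i) <= M.
    apply: le_trans (sM m); apply: ler_sum => i _; have /andP[_ si] := sd i.
    by apply: dP; rewrite ?mulr_gt0//; lra.
  rewrite -mulr_sumr -mulr_sumr; nra.
have muU := measure_bigcup_ball_le (Q := xpredT) c (fun i => ltW (s0 i)) ler01 sum_s.
set U := (X in mu X) in muU.
have mU : measurable U by apply: bigcup_measurable => i _; exact: measurable_ball.
have sub : `[0, 1]%classic `<=` U `|` Neg.
  move=> y y01; have [/cov[i _ h]|nA] := pselect (A y); last by right; exact: subNeg.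
  by left; exists i => //; rewrite mul1r.
have : (mu `[0%R, 1%R]%classic <= mu (U `|` Neg))%E.
  by apply: le_measure; rewrite ?inE//; exact: measurableU.
rewrite lebesgue_measure_itv/= lte01 -EFinB subr0 => h.
have : (mu (U `|` Neg) <= (2 * 1 * (1 / 4))%:E)%E.
  apply: le_trans (measureU2 _ _ _) _ => //.
  by rewrite -[leRHS]adde0; apply: leeD; [exact: muU|rewrite -Neg0; exact: lexx].
by move=> /(le_trans h); rewrite lee_fin; lra.
Qed.

End mass_transference.

Section min_series.
Variable R : realType.
Implicit Types u v : nat -> R.

Lemma nneseries_min1_pinfty (C : R) u v : (forall n, 0 <= u n) -> (forall n, 0 <= v n) ->
  (forall n, u n < 1 -> v n <= C * u n) ->
  (\sum_(0 <= n <oo) (v n)%:E = +oo)%E ->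
  (\sum_(0 <= n <oo) (Num.min (u n) 1)%:E = +oo)%E.
Proof.
move=> u0 v0 uv; apply: contraPP => /eqP; rewrite -ltey => fin.
have m0 n : 0 <= Num.min (u n) 1 by rewrite le_min u0 ler01.
have [N HN] := nneseries_small m0 fin (divr_gt0 ltr01 (ltr0n _ 2)).
apply/eqP; rewrite lt_eqF//.
have v0' n : (0 <= (v n)%:E)%E by rewrite lee_fin.
have m0' n : (0 <= (Num.min (u n) 1)%:E)%E by rewrite lee_fin.
rewrite (nneseries_split 0 N)// add0n sumEFin.
apply: lte_add_pinfty; first by rewrite ltry.
apply: (@le_lt_trans _ _ (`|C|%:E * \sum_(0 <= n <oo) (Num.min (u n) 1)%:E)%E); last first.
  by rewrite lte_mul_pinfty// lee_fin.
rewrite -nneseriesZl//.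
rewrite [leRHS](nneseries_split 0 N); last by move=> n _; rewrite mule_ge0// lee_fin.
rewrite add0n -[leLHS]add0e; apply: leeD.
  by apply: sume_ge0 => n _; rewrite mule_ge0// lee_fin.
rewrite -!(nneseries_addn N)//; last by move=> n; rewrite mule_ge0// lee_fin.
apply: lee_nneseries => // n _; rewrite -EFinM lee_fin.
have := HN _ (leq_addl n N); rewrite ge_min => /orP[h|]; last by lra.
have u1 : u (n + N)%N < 1 by lra.
rewrite (min_l (ltW u1)); apply: le_trans (uv _ u1) _.
by rewrite ler_wpM2r// ler_norm.
Qed.

End min_series.

Lemma lebesgue_ae_imp (R : realType) (P Q : R -> Prop) :
  (forall x, P x -> Q x) -> {ae @lebesgue_measure R, forall x, P x} ->
  {ae @lebesgue_measure R, forall x, Q x}.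
Proof. by move=> PQ; apply: negligibleS => x nQ Px; exact/nQ/PQ. Qed.

Section twisted.
Variables (R : realType) (a : nat -> int) (psi : nat -> R) (f : R -> R).
Hypothesis psi_ge0 : forall n : nat, (0 < n)%N -> 0 <= psi n.
Hypothesis f_dim : dimension_function f.
Local Notation mu := (@lebesgue_measure R).

Lemma W_itv01 alpha : W psi a alpha `<=` `[0, 1]%classic.
Proof. by move=> y []. Qed.

Lemma hausdorff_W_summable alpha :
  (\sum_(1 <= n <oo) (dimf0 f (psi n))%:E < +oo)%E ->
  hausdorff_measure f (W psi a alpha) = 0%E.
Proof.
rewrite nneseries_from1; last first.
  by move=> n n0; rewrite lee_fin (dimf0_ge0 f_dim)// psi_ge0.
move=> fin.
have l0 n : 0 <= psi n.+1 by exact: psi_ge0.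
have [N HN] : exists N, forall n, (N <= n)%N -> psi n.+1 < 1.
  have f12 : 0 < f 1 / 2 by rewrite divr_gt0// (dimension_function_gt0 f_dim).
  have [N HN] := nneseries_small (fun n => dimf0_ge0 f_dim (l0 n)) fin f12.
  exists N => n /HN; rewrite ltNge; apply: contraTN => p1.
  rewrite -ltNge /dimf0 gt_eqF ?(lt_le_trans ltr01)//.
  have := dimension_function_le f_dim ltr01 p1.
  by have := dimension_function_gt0 f_dim ltr01; lra.
pose z n := (a n)%:~R * alpha - (Num.floor ((a n)%:~R * alpha))%:~R.
pose c (p : int * bool) n := z n.+1 + p.1%:~R - (if p.2 then psi n.+1 else 0).
pose L p := [set y | infinite_set [set n | c p n <= y <= c p n + psi n.+1]].
pose s : seq (int * bool) := [seq (k, b) | k <- [:: -1; 0; 1], b <- [:: true; false]].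
have L0 : hausdorff_measure f (\big[setU/set0]_(p <- s) L p) = 0%E.
  elim/big_ind: _ => [|A B|p _]; first exact: hausdorff_measure_set0.
    exact: hausdorff_measure_setU_eq0.
  exact: hausdorff_limsup_itv0.
apply/eqP; rewrite eq_le (hausdorff_measure_ge0 f_dim) andbT -L0.
apply: (le_hausdorff_measure f).
move=> y [y01 infy]; rewrite -bigcup_seq; apply: contrapT => noL.
apply: infy; apply: (@sub_finite_set _ _ (`I_N.+1 `|`
    \bigcup_(p in [set` s]) [set n.+1 | n in [set n | c p n <= y <= c p n + psi n.+1]])).
  move=> [|n] [//= _] /dist_int_ltP[k yk].
  have [nN|Nn] := leqP n.+1 N; first by left => /=; rewrite ltnS.
  right; have p1 := HN n Nn.
  pose m := Num.floor ((a n.+1)%:~R * alpha) - k.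
  have zE : (a n.+1)%:~R * alpha - k%:~R = z n.+1 + m%:~R by rewrite /z /m intrB; ring.
  have z01 : 0 <= z n.+1 < 1.
    by rewrite /z subr_ge0 ltrBlDl -intrD1 floor_le floorD1_gt.
  have ym : `|z n.+1 + m%:~R - y| < psi n.+1 by rewrite -zE addrAC.
  move: y01 z01 (ym); rewrite in_itv/= ltr_norml => /andP[y0 y1] /andP[z0 z1] /andP[h1 h2].
  have m2 : m < 2 by rewrite -(ltr_int R); lra.
  have m2' : -2 < m by rewrite -(ltr_int R); lra.
  have ms : m \in [:: -1; 0; 1] by rewrite !inE; lia.
  have [yz|yz] := leP y (z n.+1 + m%:~R).
    exists (m, true) => /=; first by apply/allpairsP; exists (m, true).
    by exists n => //=; rewrite /c/=; apply/andP; split; lra.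
  exists (m, false) => /=; first by apply/allpairsP; exists (m, false).
  by exists n => //=; rewrite /c/=; apply/andP; split; lra.
rewrite finite_setU; split; first exact: finite_II.
apply: bigcup_finite; first exact: finite_seq.
move=> p ps; apply: finite_image; apply: contrapT => inf; apply: noL; exists p => //.
Qed.

(* Away from 0 and 1, small distances modulo 1 are distances to the fractional part. *)
Lemma W_fractional_part (phi : nat -> R) alpha y N :
  (forall e, 0 < e -> exists N, forall n, (N <= n)%N -> phi n <= e) ->
  0 < y < 1 -> W phi a alpha y ->
  exists n, [/\ (0 < n)%N, (N <= n)%N &
    `|y - ((a n)%:~R * alpha - (Num.floor ((a n)%:~R * alpha))%:~R)| < phi n].
Proof.
move=> phi0 /andP[y0 y1] [_ /infinite_set_natP inf].
have m0 : 0 < Num.min y (1 - y) by rewrite lt_min y0 subr_gt0.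
have [N1 HN1] := phi0 _ m0.
have [n Nn [n0 /dist_int_ltP[k yk]]] := inf (maxn N N1).
exists n; split => //; first exact: leq_trans (leq_maxl _ _) Nn.
have := HN1 n (leq_trans (leq_maxr _ _) Nn); rewrite le_min => /andP[p1 p2].
suff -> : Num.floor ((a n)%:~R * alpha) = k by rewrite distrC addrAC.
apply: floor_def; move: yk; rewrite ltr_norml intrD => /andP[? ?].
by apply/andP; split; lra.
Qed.

Hypothesis a_incr : forall m n : nat, (0 < m)%N -> (m < n)%N -> a m < a n.
Hypothesis div : (\sum_(1 <= n <oo) (dimf0 f (psi n))%:E = +oo)%E.

Let fpsi_ge0 n : (0 < n)%N -> 0 <= dimf0 f (psi n).
Proof. by move=> n0; rewrite (dimf0_ge0 f_dim)// psi_ge0. Qed.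

Let div' : (\sum_(0 <= n <oo) (dimf0 f (psi n.+1))%:E = +oo)%E.
Proof.
by rewrite -div nneseries_from1// => n n0; rewrite lee_fin fpsi_ge0.
Qed.

Lemma hausdorff_W_lipschitz (C : R) :
  (forall x, 0 < x -> x <= 1 -> f x <= C * x) ->
  {ae mu, forall alpha, alpha \in `[0, 1] ->
    hausdorff_measure f (W psi a alpha) = hausdorff_measure f `[0, 1]%classic}.
Proof.
move=> fC.
have divm : (\sum_(1 <= n <oo) (Num.min (psi n) 1)%:E = +oo)%E.
  rewrite nneseries_from1; last first.
    by move=> n n0; rewrite lee_fin le_min psi_ge0/=.
  apply: (@nneseries_min1_pinfty _ C _ (fun n => dimf0 f (psi n.+1))) => //.
  - by move=> n; exact: psi_ge0.
  - by move=> n; exact: fpsi_ge0.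
  - move=> n p1; rewrite /dimf0; case: eqP => [->|/eqP p0]; first by rewrite mulr0.
    by apply: fC; [rewrite lt_neqAle eq_sym p0 psi_ge0|exact: ltW].
apply: lebesgue_ae_imp (twisted_full_measure a_incr psi_ge0 divm) => alpha H /H neg.
apply/eqP; rewrite eq_le; apply/andP; split.
  by apply: (le_hausdorff_measure f); exact: W_itv01.
have N0 := hausdorff_measure_negligible f_dim fC neg.
apply: le_trans (hausdorff_measureU0 f_dim _ N0).
apply: (le_hausdorff_measure f) => y y01.
by have [?|?] := pselect (W psi a alpha y); [left|right].
Qed.

Hypothesis f_noninc :
  {in `]0, +oo[ &, {homo (fun x : R => x^-1 * f x) : x y / x <= y >-> y <= x}}.
Hypothesis f_unbounded : forall L : R, exists2 d : R, 0 < d &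
  forall x, 0 < x -> x <= d -> L * x <= f x.

Lemma hausdorff_W_pinfty :
  {ae mu, forall alpha, alpha \in `[0, 1] -> hausdorff_measure f (W psi a alpha) = +oo%E}.
Proof.
have m0 n : 0 <= Num.min (psi n.+1) 1 by rewrite le_min psi_ge0/=.
have := @nneseries_from1 R (fun n => (Num.min (psi n) 1)%:E).
have [divm|/eqP] := pselect (\sum_(0 <= n <oo) (Num.min (psi n.+1) 1)%:E = +oo)%E.
  rewrite divm => divm'; have {}divm' := divm' _.
  have {}divm' : (\sum_(1 <= n <oo) (Num.min (psi n) 1)%:E = +oo)%E.
    by apply: divm' => -[//|n] _; rewrite lee_fin.
  apply: lebesgue_ae_imp (twisted_full_measure a_incr psi_ge0 divm') => alpha H /H.
  exact: full_measure_hausdorff_pinfty.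
move=> + _; rewrite -ltey => fin.
pose r n := if n is 0%N then 0 else psi n.
have r0 e : 0 < e -> exists N, forall n, (N <= n)%N -> r n <= e.
  move=> e0; have e1 : 0 < Num.min e (1 / 2) by rewrite lt_min e0 divr_gt0.
  have [N HN] := nneseries_small m0 fin e1; exists N.+1 => -[//|n] /HN.
  by rewrite /= le_min !ge_min => /andP[/orP[//|?] /orP[?|?]]; lra.
pose phi n := dimf0 f (r n).
have rge0 n : 0 <= r n by case: n => // n; exact: psi_ge0.
have phi0 e : 0 < e -> exists N, forall n, (N <= n)%N -> phi n <= e.
  move=> e0; have [t [t0 _]] := dimension_function_right_approx f_dim (lexx 0) e0.
  rewrite /dimf0 eqxx add0r => fte; have [N HN] := r0 t t0; exists N => n /HN rt.
  by apply: le_trans (dimf0_le f_dim (rge0 n) rt) _; rewrite /dimf0 gt_eqF.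
have phi_ge0 n : (0 < n)%N -> 0 <= phi n by move=> _; exact: dimf0_ge0.
have divphi : (\sum_(1 <= n <oo) (Num.min (phi n) 1)%:E = +oo)%E.
  rewrite nneseries_from1; last by move=> n n0; rewrite lee_fin le_min phi_ge0/=.
  apply: (@nneseries_min1_pinfty _ 1 _ (fun n => dimf0 f (psi n.+1))) => //.
  - by move=> n; exact: phi_ge0.
  - by move=> n; exact: fpsi_ge0.
  - by move=> n _; rewrite mul1r.
apply: lebesgue_ae_imp (twisted_full_measure a_incr phi_ge0 divphi) => alpha H /H neg.
pose x n := (a n)%:~R * alpha - (Num.floor ((a n)%:~R * alpha))%:~R.
apply/eqP; rewrite -leye_eq -(@mass_transference _ _ f_dim f_noninc f_unbounded x r r0).
  apply: (le_hausdorff_measure f) => y [y01 io]; split; first by rewrite in_itv.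
  apply/infinite_set_natP => N; have [n Nn xr] := io N; exists n => //.
  have n0 : (0 < n)%N.
    by case: n {Nn} xr => //=; rewrite ltNge normr_ge0.
  split => //; apply/dist_int_ltP; exists (Num.floor ((a n)%:~R * alpha)).
  by move: xr; rewrite /x /r; case: n n0 {Nn} => // n _; rewrite addrAC.
apply: negligibleS (negligibleU neg (negligibleU _ _)); last first.
- by apply/negligibleP; [exact: (measurable_set1 1)|exact: lebesgue_measure_set1].
- by apply/negligibleP; [exact: (measurable_set1 0)|exact: lebesgue_measure_set1].
move=> y [y01 nio].
have [Wy|nWy] := pselect (W phi a alpha y); last by left; split.
have [->|/eqP y0] := pselect (y = 0); first by right; left.
have [->|/eqP y1] := pselect (y = 1); first by right; right.
exfalso; apply: nio => N.
have y01' : 0 < y < 1.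
  by move: y01; rewrite /= in_itv/= !lt_neqAle y1 eq_sym y0.
have [n [n0 Nn yx]] := W_fractional_part N phi0 y01' Wy; exists n => //.
have rn : r n != 0.
  by apply: contraTneq yx => rn; rewrite /phi rn /dimf0 eqxx -leNgt.
split; first by rewrite lt_neqAle eq_sym rn rge0.
by move: yx; rewrite /phi /dimf0 (negbTE rn).
Qed.

End twisted.

Lemma dimension_function_dichotomy (R : realType) (f : R -> R) :
  monotonic_on_pos (fun x : R => x^-1 * f x) ->
  (exists C : R, forall x, 0 < x -> x <= 1 -> f x <= C * x) \/
  {in `]0, +oo[ &, {homo (fun x : R => x^-1 * f x) : x y / x <= y >-> y <= x}} /\
  forall L : R, exists2 d : R, 0 < d & forall x, 0 < x -> x <= d -> L * x <= f x.
Proof.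
case=> mon.
  left; exists (f 1) => x x0 x1.
  have := mon x 1; rewrite !in_itv/= x0 ltr01 => /(_ isT isT x1).
  by rewrite invr1 mul1r ler_pdivrMl// mulrC.
have [bd|/forallNP unbd] := pselect (exists C : R, forall x, 0 < x -> x <= 1 -> f x <= C * x).
  by left.
right; split => // L.
have /existsNP[d /not_implyP[d0 /not_implyP[d1 /negP]]] := unbd L.
rewrite -ltNge => fd; exists d => // x x0 xd.
have := mon x d; rewrite !in_itv/= x0 d0 => /(_ isT isT xd) h.
rewrite -ler_pdivlMr// mulrC; apply: le_trans h.
by rewrite mulrC ler_pdivlMr// ltW.
Qed.

Unset Implicit Arguments.
Set Strict Implicit.

Theorem theorem1p3 (R : realType) (a : nat -> int) (psi : nat -> R) (f : R -> R)
    (a_incr : forall m n : nat, (0 < m)%N -> (m < n)%N -> a m < a n)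
    (psi_ge0 : forall n : nat, (0 < n)%N -> 0 <= psi n)
    (f_dim : dimension_function f)
    (f_mono : monotonic_on_pos (fun x : R => x^-1 * f x)) :
  {ae @lebesgue_measure R, forall alpha : R, alpha \in `[0, 1] ->
    ((\sum_(1 <= n <oo) (dimf0 f (psi n))%:E < +oo)%E ->
       hausdorff_measure f (W psi a alpha) = 0%E) /\
    ((\sum_(1 <= n <oo) (dimf0 f (psi n))%:E = +oo)%E ->
       hausdorff_measure f (W psi a alpha) =
       hausdorff_measure f `[0, 1]%classic)}.
Proof.
have [div|ndiv] := pselect (\sum_(1 <= n <oo) (dimf0 f (psi n))%:E = +oo)%E; last first.
  by apply: aeW => alpha _; split => // fin; exact: hausdorff_W_summable.
suff : {ae @lebesgue_measure R, forall alpha : R, alpha \in `[0, 1] ->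
    hausdorff_measure f (W psi a alpha) = hausdorff_measure f `[0, 1]%classic}.
  by apply: lebesgue_ae_imp => alpha H /H ->; rewrite div ltxx.
have [[C fC]|[f_noninc f_unbounded]] := dimension_function_dichotomy f_mono.
  exact: hausdorff_W_lipschitz fC.
apply: lebesgue_ae_imp (hausdorff_W_pinfty psi_ge0 f_dim a_incr div f_noninc f_unbounded).
move=> alpha H /H HW; rewrite HW; apply/esym/eqP; rewrite -leye_eq -HW.
exact/(le_hausdorff_measure f)/W_itv01.
Qed.
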